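(* Fix integers $j\ge i\ge 1$. The \textsc{$k$-Dominating Set} problem, parameterized by $k$ and restricted to input graphs that contain no subgraph isomorphic to $K_{i,j}$, has a polynomial kernel with $O\big((j+1)^{2(i+1)}k^{2i^{2}}\big)$ vertices.
   Context: All graphs are finite, simple and undirected. A dominating set of a graph $G=(V,E)$ is a set $S\subseteq V$ such that every vertex of $V\setminus S$ is adjacent to some vertex of $S$. The \textsc{$k$-Dominating Set} problem: given a graph $G$ and a positive integer $k$, decide whether $G$ has a dominating set of size at most $k$; the parameter is $k$. $K_{i,j}$ denotes the complete bipartite graph with parts of sizes $i$ and $j$; a graph is $K_{i,j}$-free if it has no (not necessarily induced) subgraph isomorphic to $K_{i,j}$. A kernel (kernelization algorithm) for the problem is a polynomial-time algorithm that, given $(G,k)$, outputs an instance $(G',k')$ such that the size of $G'$ is bounded by a function $g(k)$ of $k$ alone, $k'\le h(k)$ for some function $h$, and $G$ has a dominating set of size at most $k$ if and only if $G'$ has a dominating set of size at most $k'$. The kernel is polynomial if $g$ is a polynomial; here the bound on the number of vertices of $G'$ is as stated. *)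

(* Defs.v *)
From mathcomp Require Import all_boot.

Set Implicit Arguments.
Unset Strict Implicit.
Unset Printing Implicit Defensive.

(* Vertices are numbered 0, ..., nv - 1, as in the input of an algorithm. *)
Record graph := Graph {
  nv : nat;
  adj : rel 'I_nv;
  adj_sym : symmetric adj;
  adj_irr : irreflexive adj
}.

Definition dominating (G : graph) (S : {set 'I_(nv G)}) : Prop :=
  forall v, v \notin S -> exists2 u, u \in S & adj u v.

(* Not necessarily induced. *)
Definition has_subgraph (H G : graph) : Prop :=
  exists f : 'I_(nv H) -> 'I_(nv G),
    injective f /\ forall u v, adj u v -> adj (f u) (f v).

Section CompleteBipartite.

Variables i j : nat.

Definition Kadj : rel 'I_(i + j) := fun u v => (u < i) != (v < i).

Lemma Kadj_sym : symmetric Kadj.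
Proof. by move=> u v; rewrite /Kadj eq_sym. Qed.

Lemma Kadj_irr : irreflexive Kadj.
Proof. by move=> u; rewrite /Kadj eqxx. Qed.

Definition complete_bipartite : graph := Graph Kadj_sym Kadj_irr.

End CompleteBipartite.

Definition instance : Type := graph * nat.

(* [valid] selects the instances of the problem, [yes] those to be accepted;  *)
(* the second component of an instance is the parameter.                      *)
Record problem := Problem {
  valid : instance -> Prop;
  yes : instance -> Prop
}.

Definition dominating_set_K_free (i j : nat) : problem := {|
  valid I := 0 < I.2 /\ ~ has_subgraph (complete_bipartite i j) I.1;
  yes I := exists2 S : {set 'I_(nv I.1)}, dominating S & #|S| <= I.2
|}.

(* Sizes in bits: an adjacency matrix, and k written in binary.               *)
Definition gsize (G : graph) : nat := nv G ^ 2.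

Definition isize (I : instance) : nat := gsize I.1 + (trunc_log 2 I.2).+1.

(* Algorithms are structured programs for a unit-cost random access machine   *)
(* with registers and arrays of natural numbers. Addition and truncated       *)
(* subtraction are the only arithmetic operations: without multiplication,    *)
(* numbers have length linear in the running time (plus the input), so that   *)
(* polynomial time is the same as for Turing machines.                        *)
Inductive expr :=
  | Const of nat
  | Reg of nat
  | Read of nat & expr                 (* Read a e is the cell a[e] *)
  | Plus of expr & expr
  | Minus of expr & expr.

Inductive cmd :=
  | Skip
  | Assign of nat & expr               (* Assign x e is x := e *)
  | Write of nat & expr & expr         (* Write a e1 e2 is a[e1] := e2 *)
  | Seq of cmd & cmd
  | If of expr & cmd & cmd             (* a condition holds if it is not 0 *)
  | While of expr & cmd.

Record store := Store {
  reg : nat -> nat;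
  arr : nat -> nat -> nat
}.

Definition set_reg (s : store) (x v : nat) : store :=
  Store (fun y => if y == x then v else reg s y) (arr s).

Definition set_arr (s : store) (a m v : nat) : store :=
  Store (reg s)
    (fun b l => if (b == a) && (l == m) then v else arr s b l).

Fixpoint eval (s : store) (e : expr) : nat :=
  match e with
  | Const n => n
  | Reg x => reg s x
  | Read a e1 => arr s a (eval s e1)
  | Plus e1 e2 => eval s e1 + eval s e2
  | Minus e1 e2 => eval s e1 - eval s e2
  end.

Fixpoint cost (e : expr) : nat :=
  match e with
  | Const _ | Reg _ => 1
  | Read _ e1 => (cost e1).+1
  | Plus e1 e2 | Minus e1 e2 => (cost e1 + cost e2).+1
  end.

(* exec c s t s' : from s, the program c halts in s' after exactly t steps.   *)
Inductive exec : cmd -> store -> nat -> store -> Prop :=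
  | ExecSkip s : exec Skip s 1 s
  | ExecAssign s x e :
      exec (Assign x e) s (cost e).+1 (set_reg s x (eval s e))
  | ExecWrite s a e1 e2 :
      exec (Write a e1 e2) s (cost e1 + cost e2).+1
        (set_arr s a (eval s e1) (eval s e2))
  | ExecSeq s1 s2 s3 c1 c2 t1 t2 :
      exec c1 s1 t1 s2 -> exec c2 s2 t2 s3 ->
      exec (Seq c1 c2) s1 (t1 + t2) s3
  | ExecIfTrue s s' e c1 c2 t :
      eval s e != 0 -> exec c1 s t s' ->
      exec (If e c1 c2) s (cost e + t).+1 s'
  | ExecIfFalse s s' e c1 c2 t :
      eval s e = 0 -> exec c2 s t s' ->
      exec (If e c1 c2) s (cost e + t).+1 s'
  | ExecWhileFalse s e c :
      eval s e = 0 -> exec (While e c) s (cost e).+1 s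
  | ExecWhileTrue s1 s2 s3 e c t1 t2 :
      eval s1 e != 0 -> exec c s1 t1 s2 -> exec (While e c) s2 t2 s3 ->
      exec (While e c) s1 (cost e + t1 + t2).+1 s3.

(* Registers 0 and 1 hold the number of vertices and the parameter; array 0   *)
(* holds the adjacency matrix in row-major order.                             *)
Definition represents (s : store) (I : instance) : Prop :=
  [/\ reg s 0 = nv I.1,
      reg s 1 = I.2 &
      forall u v : 'I_(nv I.1), arr s 0 (u * nv I.1 + v) = adj u v].

Definition nat_adj (G : graph) (u v : nat) : bool :=
  match insub u, insub v with
  | Some u', Some v' => @adj G u' v'
  | _, _ => false
  end.

Definition input_store (I : instance) : store :=
  let n := nv I.1 in
  Store
    (fun x => if x == 0 then n else if x == 1 then I.2 else 0)
    (fun a m => if a == 0 then (nat_adj I.1 (m %/ n) (m %% n) : nat) else 0).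

Definition outputs (A : cmd) (I : instance) (t : nat) (I' : instance) : Prop :=
  exists2 s, exec A (input_store I) t s & represents s I'.

Definition polynomially_bounded (g : nat -> nat) : Prop :=
  exists c d, forall x, g x <= c * x ^ d + c.

Definition polynomial_time (P : problem) (A : cmd) : Prop :=
  exists2 T, polynomially_bounded T &
    forall I, valid P I -> exists t I', outputs A I t I' /\ t <= T (isize I).

(* The output has to be an instance of the same problem.                      *)
Definition kernelization (P : problem) (g h : nat -> nat) (A : cmd) : Prop :=
  polynomial_time P A /\
  forall I t I', valid P I -> outputs A I t I' ->
    [/\ valid P I', gsize I'.1 <= g I.2, I'.2 <= h I.2 & yes P I <-> yes P I'].

Definition polynomial_kernel (P : problem) (A : cmd) : Prop :=
  exists g h, polynomially_bounded g /\ kernelization P g h A.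

Definition kernel_nv_le (P : problem) (A : cmd) (b : nat -> nat) : Prop :=
  forall I t I', valid P I -> outputs A I t I' -> nv I'.1 <= b I.2.

(* Main.v *)
Require Import Defs.
From mathcomp Require Import all_boot zify.

(* All vertices start blue, i.e. to be dominated. A set X of i vertices has    *)
(* fewer than j common neighbours. Inductively, let the sets of t + 1 vertices *)
(* have at most d common blue neighbours each; if a set X of t vertices has    *)
(* more than k(d + 1), then every solution of size at most k meets X, because  *)
(* a vertex outside X dominates at most d + 1 of them. So all but k(d + 1) + 1 *)
(* of them may be made non-blue: those left still force the solution to meet   *)
(* X, hence to dominate the others. For the empty set X this bounds the set B  *)
(* of blue vertices by O(j k^i). Of the remaining vertices only one for each   *)
(* trace on B is needed, and as the graph is K_{i,j}-free there are O(j |B|^i) *)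
(* of these. Finally a non-blue vertex gets a pendant path of length 2, whose  *)
(* middle vertex can be assumed to be in the solution; k grows by the number   *)
(* of paths, and for i > 1 no K_{i,j} contains a vertex of such a path.        *)
(* If i = 1, no vertices outside B are kept and no paths are added: either B   *)
(* is everything, or both instances are no-instances.                          *)

Set Implicit Arguments.
Unset Strict Implicit.
Unset Printing Implicit Defensive.

(** * Running programs *)

(** Shrinking the blue set [B] is sound by [reducedS]: vertices leave it from [cn X] only if enough
    remain there to force, by [dominates_meets], every small solution to meet X, and then the
    removed vertices are dominated too. K_{i,j}-freeness starts this induction with fewer than j
    common neighbours of i vertices ([card_cn]); it ends at the empty set with [#|B| <= thr j k i],
    of order j k^i. Freeness also bounds the kept vertices ([card_kept]), to which solutions can be
    moved ([dominates_kept]). In the output graph, [out_yes2] and [out_free2] justify the pendant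
    paths for i > 1, while [out_free1] and [out_yes1] settle i = 1. [kernel_size] composes the
    bounds: with |B| = O(j k^i), the j |B|^i representatives give (j + 1)^(i + 1) k^(i^2) up to
    powers of 3, which a second factor (j + 1)^(i + 1) absorbs.

    For the algorithm, [run] combines termination, a postcondition and a time bound that is
    polynomial in the largest number of iterations of a loop ([tbound_exp]). The degree grows with
    the nesting of loops, hence with i, which is fixed. [exec_det] transfers what is proved of one
    execution to every output. *)

Lemma exec_det c s t s1 : exec c s t s1 ->
  forall t' s2, exec c s t' s2 -> s1 = s2.
Proof.
elim=> {c s t s1}.
- by move=> s t' s2 E; inversion E.
- by move=> s x e t' s2 E; inversion E.
- by move=> s a e1 e2 t' s2 E; inversion E.
- move=> s1 s2 s3 c1 c2 t1 t2 _ IH1 _ IH2 t' s' E; inversion E; subst.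
  match goal with
    h1 : exec c1 _ _ _, h2 : exec c2 _ _ _ |- _ =>
      move: h2; rewrite -(IH1 _ _ h1); exact: IH2
  end.
- move=> s s' e c1 c2 t /eqP N _ IH t' s2 E.
  by inversion E; subst; [eauto | congruence].
- move=> s s' e c1 c2 t Z _ IH t' s2 E.
  inversion E; subst; last by eauto.
  by match goal with h : is_true (eval s e != 0) |- _ => rewrite Z in h end.
- move=> s e c Z t' s2 E; inversion E; subst=> //.
  by match goal with h : is_true (eval s e != 0) |- _ => rewrite Z in h end.
- move=> s1 s2 s3 e c t1 t2 /eqP N _ IH1 _ IH2 t' s' E.
  inversion E; subst; first congruence.
  match goal with
    h1 : exec c _ _ _, h2 : exec (While _ _) _ _ _ |- _ =>
      move: h2; rewrite -(IH1 _ _ h1); exact: IH2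
  end.
Qed.

(** Syntactic over-approximations of what a program writes: for concrete programs the frame
    conditions of the rules are decided by computation. *)
Fixpoint modr (c : cmd) : seq nat :=
  match c with
  | Assign x _ => [:: x]
  | Seq c1 c2 | If _ c1 c2 => modr c1 ++ modr c2
  | While _ c1 => modr c1
  | _ => [::]
  end.

Fixpoint moda (c : cmd) : seq nat :=
  match c with
  | Write a _ _ => [:: a]
  | Seq c1 c2 | If _ c1 c2 => moda c1 ++ moda c2
  | While _ c1 => moda c1
  | _ => [::]
  end.

Definition unch (c : cmd) (s s' : store) : Prop :=
  (forall x, x \notin modr c -> reg s' x = reg s x) /\
  (forall a l, a \notin moda c -> arr s' a l = arr s a l).

Lemma unch_trans c s1 s2 s3 : unch c s1 s2 -> unch c s2 s3 -> unch c s1 s3.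
Proof.
case=> r1 a1 [r2 a2]; split=> [x xc | a l ac]; first by rewrite r2 ?r1.
by rewrite a2 ?a1.
Qed.

Lemma unch_sub c c' s s' : {subset modr c <= modr c'} ->
  {subset moda c <= moda c'} -> unch c s s' -> unch c' s s'.
Proof.
move=> sr sa [r a]; split=> [x xc | b l bc].
  by apply: r; apply: contra xc; apply: sr.
by apply: a; apply: contra bc; apply: sa.
Qed.

Lemma exec_unch c s t s' : exec c s t s' -> unch c s s'.
Proof.
elim=> {c s t s'} //=.
- by move=> s x e; split=> //= y; rewrite inE => /negPf->.
- by move=> s b e1 e2; split=> //= a l; rewrite inE => /negPf->.
- move=> s1 s2 s3 c1 c2 t1 t2 _ U1 _ U2; apply: (@unch_trans _ _ s2).
    by apply: unch_sub U1 => x /= xc; rewrite mem_cat xc.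
  by apply: unch_sub U2 => x /= xc; rewrite mem_cat xc orbT.
- by move=> s s' e c1 c2 t _ _; apply: unch_sub => x /= xc; rewrite mem_cat xc.
- move=> s s' e c1 c2 t _ _; apply: unch_sub => x /= xc.
    by rewrite mem_cat xc orbT.
  by rewrite mem_cat xc orbT.
- by move=> s1 s2 s3 e c t1 t2 _ _ U1 _ U2; apply: unch_trans U2.
Qed.

(* Bounds the running time of a program all of whose loops iterate at most m   *)
(* times.                                                                      *)
Fixpoint tbound (m : nat) (c : cmd) : nat :=
  match c with
  | Skip => 1
  | Assign _ e => (cost e).+1
  | Write _ e1 e2 => (cost e1 + cost e2).+1
  | Seq c1 c2 => tbound m c1 + tbound m c2
  | If e c1 c2 => (cost e + (tbound m c1 + tbound m c2)).+1
  | While e c1 => m.+1 * (cost e + tbound m c1).+1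
  end.

(** As the base is at least 2, constants and sums are absorbed into the exponent, and a loop costs
    one more factor [m.+2]. The exponent depends on the program alone, not on the input. *)
Lemma tbound_exp c : exists d, forall m, tbound m c <= m.+2 ^ d.
Proof.
have const a : exists d, forall m, a <= m.+2 ^ d.
  exists a => m; apply: (@leq_trans (2 ^ a)); first exact/ltnW/ltn_expl.
  by case: a => // a; rewrite leq_exp2r.
have add f g : (exists d, forall m, f m <= m.+2 ^ d) ->
    (exists d, forall m, g m <= m.+2 ^ d) ->
    exists d, forall m, f m + g m <= m.+2 ^ d.
  move=> [d1 h1] [d2 h2]; exists (d1 + d2).+1 => m.
  have l1 : m.+2 ^ d1 <= m.+2 ^ (d1 + d2) by rewrite leq_exp2l // leq_addr.
  have l2 : m.+2 ^ d2 <= m.+2 ^ (d1 + d2) by rewrite leq_exp2l // leq_addl.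
  rewrite expnS; move: (h1 m) (h2 m); move: (m.+2 ^ (d1 + d2)) l1 l2; nia.
have S f : (exists d, forall m, f m <= m.+2 ^ d) ->
    exists d, forall m, (f m).+1 <= m.+2 ^ d.
  by move=> hf; have [d hd] := add _ _ (const 1) hf; exists d.
elim: c => /= [|_ e|_ e1 e2|c1 IH1 c2 IH2|e c1 IH1 c2 IH2|e c1 IH1];
  try by apply: const.
- exact: (add _ _ IH1 IH2).
- exact: (S _ (add _ _ (const _) (add _ _ IH1 IH2))).
- have [d hd] := S _ (add _ _ (const (cost e)) IH1).
  by exists d.+1 => m; rewrite expnS leq_mul.
Qed.

(** Total correctness from one start store; a single m for all loops keeps the time bound
    syntactic. *)
Definition run (m : nat) (c : cmd) (s : store) (Q : store -> Prop) : Prop :=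
  exists t s', [/\ exec c s t s', t <= tbound m c & Q s'].

Section Rules.

Variable m : nat.
Implicit Types (c : cmd) (s : store) (e : expr) (Q : store -> Prop).

Lemma run_mono c s Q Q' : run m c s Q ->
  (forall s', unch c s s' -> Q s' -> Q' s') -> run m c s Q'.
Proof.
move=> [t [s' [E b q]]] QQ; exists t, s'; split=> //.
by apply: QQ q; apply: exec_unch E.
Qed.

Lemma run_skip s Q : Q s -> run m Skip s Q.
Proof. by exists 1, s; split=> //; constructor. Qed.

Lemma run_assign x e s Q :
  Q (set_reg s x (eval s e)) -> run m (Assign x e) s Q.
Proof. by do 2!eexists; split; [constructor | | ]. Qed.

Lemma run_write a e1 e2 s Q :
  Q (set_arr s a (eval s e1) (eval s e2)) -> run m (Write a e1 e2) s Q.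
Proof. by do 2!eexists; split; [constructor | | ]. Qed.

Lemma run_seq c1 c2 s Q :
  run m c1 s (fun s1 => unch c1 s s1 -> run m c2 s1 Q) ->
  run m (Seq c1 c2) s Q.
Proof.
move=> [t1 [s1 [E1 b1 /(_ (exec_unch E1)) [t2 [s2 [E2 b2 q]]]]]].
exists (t1 + t2), s2; split=> //; last exact: leq_add.
exact: ExecSeq E1 E2.
Qed.

Lemma run_if e c1 c2 s Q :
  (eval s e != 0 -> run m c1 s Q) -> (eval s e = 0 -> run m c2 s Q) ->
  run m (If e c1 c2) s Q.
Proof.
move=> h1 h2; have [z | nz] := eqVneq (eval s e) 0.
  have [t [s' [E b q]]] := h2 z; exists (cost e + t).+1, s'.
  split=> //; first exact: ExecIfFalse.
  by rewrite /= ltnS leq_add2l (leq_trans b) ?leq_addl.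
have [t [s' [E b q]]] := h1 nz; exists (cost e + t).+1, s'.
split=> //; first exact: ExecIfTrue.
by rewrite /= ltnS leq_add2l (leq_trans b) ?leq_addr.
Qed.

End Rules.

Definition For (x : nat) (e : expr) (c : cmd) : cmd :=
  Seq (Assign x (Const 0))
    (While (Minus e (Reg x)) (Seq c (Assign x (Plus (Reg x) (Const 1))))).

(* The invariant must not depend on the loop counter x, which is given as the  *)
(* first argument of I instead.                                                *)
Lemma run_for m x e c s N (I : nat -> store -> Prop) (Q : store -> Prop) :
  N <= m -> x \notin modr c ->
  (forall s', unch (For x e c) s s' -> eval s' e = N) ->
  (forall a s' v, I a s' -> I a (set_reg s' x v)) ->
  I 0 s ->
  (forall a s', a < N -> unch (For x e c) s s' -> reg s' x = a -> I a s' ->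
    run m c s' (I a.+1)) ->
  (forall s', unch (For x e c) s s' -> I N s' -> Q s') ->
  run m (For x e c) s Q.
Proof.
move=> Nm xc eN Ix I0 IS IQ; apply/run_seq/run_assign => /=.
set s0 := set_reg s x 0.
set w := While _ _; set b := (cost (Minus e (Reg x)) +
  tbound m (Seq c (Assign x (Plus (Reg x) (Const 1))))).+1 => _.
(* Here a is the number of iterations still to come; [a.+1] also counts the final, failing test. *)
suff H a s' : a <= N -> unch (For x e c) s s' -> reg s' x = N - a ->
    I (N - a) s' ->
    exists t s'', [/\ exec w s' t s'', t <= a.+1 * b & Q s''].
  have [||||t [s'' [E tb q]]] := H N s0.
  - by [].
  - by split=> // y; rewrite inE negb_or => /andP[/negPf yx _] /=; rewrite yx.
  - by rewrite subnn /= eqxx.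
  - by rewrite subnn; apply: Ix.
  exists t, s''; split=> //; apply: leq_trans tb _.
  by rewrite leq_mul.
elim: a s' => [|a IH] s' aN U xE Ia.
  exists (cost (Minus e (Reg x))).+1, s'; split; last first.
  - by rewrite subn0 in Ia; apply: IQ.
  - by rewrite mul1n ltnS leq_addr.
  by apply: ExecWhileFalse => /=; rewrite eN // xE subn0 subnn.
have lt : N - a.+1 < N by rewrite subnSK // leq_subr.
have [t1 [s1 [E1 b1 I1]]] := IS _ _ lt U xE Ia.
have U1 := exec_unch E1.
have x1 : reg s1 x = N - a.+1 by case: U1 => [-> //].
pose e1 := Plus (Reg x) (Const 1).
have [||||t2 [s2 [E2 b2 q]]] := IH (set_reg s1 x (eval s1 e1)).
- exact: ltnW.
- apply: unch_trans U _; split=> /= [y | ar l].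
    rewrite inE mem_cat !negb_or => /and3P[/negPf-> yc _].
    by case: U1 => [-> //].
  by rewrite cats0 => ?; case: U1 => [_ -> //].
- by rewrite /= eqxx x1 addn1 subnSK.
- by apply: Ix; rewrite -subnSK.
exists (cost (Minus e (Reg x)) + (t1 + (cost e1).+1) + t2).+1, s2.
split=> //; last first.
  by rewrite mulSn -addSn leq_add // ltnS leq_add2l /= leq_add2r.
apply: ExecWhileTrue E2.
  by rewrite /= eN // xE subn_eq0 -ltnNge.
by apply: ExecSeq E1 _; constructor.
Qed.

(** * Reduction of the set of vertices to be dominated *)

Section Reduction.

Variable G : graph.
Implicit Types (u v w : 'I_(nv G)) (B S X Y : {set 'I_(nv G)}).

Definition cn X := [set w | [forall u in X, adj u w]].

Definition cl u := [set w | (w == u) || adj u w].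

Definition dominates S B := B \subset \bigcup_(u in S) cl u.

Lemma dominatesP S B :
  reflect (forall v, v \in B -> v \notin S -> exists2 u, u \in S & adj u v)
    (dominates S B).
Proof.
apply: (iffP subsetP) => [d v vB vS | d v vB].
  have /bigcupP[u uS] := d v vB; rewrite inE => /orP[/eqP vu | uv].
    by rewrite vu uS in vS.
  by exists u.
have [vS | vS] := boolP (v \in S).
  by apply/bigcupP; exists v => //; rewrite inE eqxx.
have [u uS uv] := d v vB vS.
by apply/bigcupP; exists u => //; rewrite inE uv orbT.
Qed.

Lemma dominating_dominates S : dominating S <-> dominates S setT.
Proof.
split=> [d | /dominatesP d v vS]; last exact: d (in_setT v) vS.
by apply/dominatesP => v _; apply: d.
Qed.

Lemma card_bigcup_le (I T : finType) (A : {set I}) (F : I -> {set T}) d :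
  (forall a, a \in A -> #|F a| <= d) -> #|\bigcup_(a in A) F a| <= #|A| * d.
Proof.
move=> Fd; apply: (@leq_trans (\sum_(a in A) #|F a|)).
  elim/big_rec2: _ => [|a y x _ xy]; first by rewrite cards0.
  by rewrite (leq_trans (leq_card_setU _ _)) // leq_add2l.
by rewrite -sum_nat_const; apply: leq_sum.
Qed.

(* A set S avoiding X would be too small: each of its elements v dominates    *)
(* only v and vertices of cn (v |: X).                                        *)
Lemma dominates_meets k d S X B :
  #|S| <= k -> dominates S B ->
  (forall v, v \notin X -> #|B :&: cn (v |: X)| <= d) ->
  k * d.+1 < #|B :&: cn X| -> exists2 x, x \in X & x \in S.
Proof.
move=> Sk SB Xd lt; apply/exists_inP; apply: contraTT lt => /exists_inPn XS.
rewrite -leqNgt; apply: (@leq_trans (#|S| * d.+1)); last first.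
  by rewrite leq_mul2r Sk orbT.
have sub : B :&: cn X \subset \bigcup_(v in S) (v |: (B :&: cn (v |: X))).
  apply/subsetP => w /setIP[wB wX]; have /bigcupP[v vS] := subsetP SB w wB.
  rewrite inE => wv; apply/bigcupP; exists v => //.
  rewrite inE in_set1; case/orP: wv => [-> // | vw].
  rewrite in_setI wB inE; apply/orP; right; apply/forall_inP => u.
  rewrite inE => /orP[/set1P-> // | uX].
  by move: wX; rewrite inE => /forall_inP; apply.
apply: leq_trans (subset_leq_card sub) _; apply: card_bigcup_le => v vS.
rewrite cardsU1; apply: (@leq_trans (1 + #|B :&: cn (v |: X)|)).
  by rewrite leq_add2r leq_b1.
by rewrite add1n ltnS Xd //; apply: contraL vS => /XS.
Qed.

(** X and Y are disjoint because [adj] is irreflexive; edges inside X or Y do no harm, as the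
    subgraph need not be induced. *)
Lemma bipartite_subgraph i j X Y :
  #|X| = i -> j <= #|Y| -> Y \subset cn X ->
  has_subgraph (complete_bipartite i j) G.
Proof.
move=> Xi jY YX.
have XY u w : u \in X -> w \in Y -> adj u w.
  by move=> uX /(subsetP YX); rewrite inE => /forall_inP; apply.
pose x (a : 'I_i) := enum_val (cast_ord (esym Xi) a).
pose y (a : 'I_j) := enum_val (widen_ord jY a).
have xX a : x a \in X by apply: enum_valP.
have yY a : y a \in Y by apply: enum_valP.
have x_inj : injective x by move=> a b /enum_val_inj /cast_ord_inj.
have y_inj : injective y.
  by move=> a b /enum_val_inj /(congr1 val) /= ab; apply: val_inj.
have xNy a b : x a <> y b.
  by move=> ab; have := XY _ _ (xX a) (yY b); rewrite ab adj_irr.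
pose f (a : 'I_(i + j)) := match split a with inl b => x b | inr c => y c end.
have f_inj : injective f.
  move=> u v; rewrite /f; case: split_ordP => a ->; case: split_ordP => b -> ab.
  - by rewrite (x_inj a b).
  - by case: (xNy a b).
  - by case: (xNy b a).
  - by rewrite (y_inj a b).
exists f; split=> //; suff adjf a b : Kadj a b -> adj (f a) (f b) by [].
rewrite /f /Kadj; case: split_ordP => c _; case: split_ordP => d _ //= _.
  exact: XY.
by rewrite adj_sym XY.
Qed.

Lemma card_cn i j X : 0 < j -> ~ has_subgraph (complete_bipartite i j) G ->
  #|X| = i -> #|cn X| <= j.-1.
Proof.
move=> j0 free Xi; rewrite -ltnS prednK // ltnNge.
by apply/negP => jX; apply/free/(bipartite_subgraph Xi jX).
Qed.

(* A bound on the number of common blue neighbours of i - s vertices.          *)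
Fixpoint thr (j k s : nat) : nat :=
  if s is s'.+1 then k * (thr j k s').+1 + 1 else j.-1.

(** Ensures that a blue set of at most [thr j k 1] vertices is not cut at any level. *)
Lemma thr1_le j k s : 0 < k -> thr j k 1 <= thr j k s.+1.
Proof.
move=> k0; elim: s => [//|s IH]; apply: leq_trans IH _.
rewrite -[thr j k s.+2]/(k * (thr j k s.+1).+1 + 1); move: (thr j k s.+1) => t.
by rewrite addn1 (leq_trans (leqnSn t)) // leqW // leq_pmull.
Qed.

(** Each level multiplies by k and adds k + 1, which is at most 2 k^(s+1); this is the source of
    [2 * s]. *)
Lemma thr_le j k s : 0 < k -> thr j k s <= (j + 2 * s) * k ^ s.
Proof.
move=> k0; elim: s => [|s IH] /=; first by rewrite muln0 addn0 muln1 leq_pred.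
rewrite expnS; have : 0 < k ^ s by rewrite expn_gt0 k0.
move: (thr _ _ _) (k ^ s) IH => t p IH p0.
have e : (j + 2 * s.+1) * (k * p) = k * ((j + 2 * s) * p) + 2 * (k * p) by lia.
have l1 : k * t <= k * ((j + 2 * s) * p) by rewrite leq_mul2l IH orbT.
have l2 : k <= k * p by rewrite leq_pmulr.
by rewrite e mulnS; lia.
Qed.

(* Here #|X| + s.+1 = i, and Z holds for the vertices v such that v |: X has    *)
(* been treated. The last clause matters only for i = 1.                       *)
Definition extended j k s X (Z : pred nat) B B' : Prop :=
  [/\ B' \subset B,
      forall v, Z v -> v \notin X -> #|B' :&: cn (v |: X)| <= thr j k s,
      forall S, #|S| <= k -> dominates S B' -> dominates S B &
      #|B| <= thr j k 1 -> B' = B].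

(** The third clause is the direction with content; the converse follows from [B' \subset B]. *)
Definition reduced j k s X B B' : Prop :=
  [/\ B' \subset B,
      #|B' :&: cn X| <= thr j k s,
      forall S, #|S| <= k -> dominates S B' -> dominates S B &
      #|B| <= thr j k 1 -> B' = B].

Lemma extended_refl j k s X B : extended j k s X pred0 B B.
Proof. by split. Qed.

(** The bounds for earlier vertices survive because the blue set only shrinks. *)
Lemma extended_step j k s X a v B B1 B2 : val v = a ->
  extended j k s X (fun b => b < a) B B1 ->
  (v \notin X -> reduced j k s (v |: X) B1 B2) -> (v \in X -> B2 = B1) ->
  extended j k s X (fun b => b < a.+1) B B2.
Proof.
move=> va [B1B B1d B1s B1e] red eq2.
have [vX | vX] := boolP (v \in X).
  rewrite eq2 //; split=> // w.
  rewrite ltnS leq_eqVlt => /orP[/eqP wa | /B1d //].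
  by rewrite (_ : w = v) ?vX //; apply: val_inj; rewrite va.
have [B2B B2d B2s B2e] := red vX.
split=> [|w||].
- exact: subset_trans B1B.
- rewrite ltnS leq_eqVlt => /orP[/eqP wa wX | wa wX].
    by rewrite (_ : w = v) //; apply: val_inj; rewrite va.
  apply: leq_trans (B1d w wa wX); apply: subset_leq_card; exact: setSI.
- by move=> S Sk SB; apply: B1s => //; apply: B2s.
- by move=> Bk; rewrite B2e ?B1e.
Qed.

Lemma reduced0 i j k X B : 0 < j ->
  ~ has_subgraph (complete_bipartite i j) G -> #|X| = i -> reduced j k 0 X B B.
Proof.
move=> j0 free Xi; split=> //; apply: leq_trans (card_cn j0 free Xi).
exact/subset_leq_card/subsetIr.
Qed.

(** If anything was cut, exactly k(d + 1) + 1 blue common neighbours of X are left, where d is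
    [thr j k s]. One more than k(d + 1) makes [dominates_meets] apply, and a solution vertex in X
    dominates all that was cut from [cn X]. *)
Lemma reducedS j k s X B B1 B2 : 0 < k ->
  extended j k s X (fun b => b < nv G) B B1 ->
  B2 \subset B1 -> B1 :\: B2 \subset cn X -> #|B2 :&: cn X| <= thr j k s.+1 ->
  B2 = B1 \/ #|B2 :&: cn X| = thr j k s.+1 -> reduced j k s.+1 X B B2.
Proof.
move=> k0 [B1B B1d B1s B1e] B21 cut B2d full; split=> //.
- exact: subset_trans B1B.
- move=> S Sk SB2; apply: B1s => //; case: full => [<- // | full].
  have [||x xX xS] := @dominates_meets k (thr j k s) S X B2 Sk SB2.
  + move=> v vX; apply: leq_trans (B1d v (ltn_ord v) vX).
    by apply: subset_leq_card; exact: setSI.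
  + by rewrite full /= addn1 leqnn.
  apply/subsetP => w wB1; have [/(subsetP SB2) // | wB2] := boolP (w \in B2).
  have : w \in cn X by rewrite (subsetP cut) // inE wB2.
  rewrite inE => /forall_inP/(_ x xX) xw.
  by apply/bigcupP; exists x; rewrite // inE xw orbT.
(* After a cut, [B2 :&: cn X] alone would have at least [thr j k 1] elements, as many as B can
   have. *)
- move=> Bk; have e := B1e Bk; rewrite -e in Bk *; case: full => // full.
  apply/eqP; rewrite eqEcard B21 /=; apply: leq_trans Bk _.
  apply: leq_trans (thr1_le j s k0) _; rewrite -full.
  exact/subset_leq_card/subsetIl.
Qed.

Lemma reduced_set0 j k s B' : reduced j k s set0 setT B' ->
  #|B'| <= thr j k s.
Proof.
case=> _ + _ _; rewrite (_ : cn set0 = setT) ?setIT //.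
by apply/setP => w; rewrite !inE; apply/forall_inP => u; rewrite inE.
Qed.

(** * The vertices that are kept *)

Definition nb B v := [set w in B | adj v w].

Definition first B v := [forall u : 'I_(nv G), (u < v) ==> (nb B u != nb B v)].

Definition kept i B := [set v | (v \in B) || (1 < i) && first B v].

Lemma first_exists B v : exists2 u, nb B u = nb B v & first B u.
Proof.
have v0 : nb B v == nb B v by [].
pose u := [arg min_(u < v | nb B u == nb B v) u]; exists u.
  by rewrite /u; case: arg_minnP => // w /eqP.
apply/forallP => w; apply/implyP; apply: contraTneq => ww.
rewrite /u in ww *; case: arg_minnP ww => // x /eqP xv xm ww.
by rewrite -leqNgt; apply: xm; rewrite ww xv.
Qed.

(** Outside B a vertex matters only through its trace and may be exchanged for the representative of
    that trace. A vertex of B also dominates itself, so it stays. *)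
Lemma dominates_kept i B S : 1 < i -> dominates S B ->
  exists S', [/\ S' \subset kept i B, #|S'| <= #|S| & dominates S' B].
Proof.
move=> i1 /dominatesP SB.
pose r v := if v \in B then v else
  odflt v [pick u | (nb B u == nb B v) && first B u].
have rP v : nb B (r v) = nb B v /\ r v \in kept i B.
  rewrite /r inE i1 /=; have [-> // | vB] := boolP (v \in B).
  case: pickP => [u /andP[/eqP-> ->] | no]; first by rewrite orbT.
  by have [u uv uf] := first_exists B v; have := no u; rewrite uv uf eqxx.
exists (r @: S); split; last 1 first.
- apply/dominatesP => v vB vS.
  have {}vS : v \notin S.
    by apply: contra vS => vS; apply/imsetP; exists v; rewrite // /r vB.
  have [u uS uv] := SB v vB vS; exists (r u); first exact: imset_f.
  have: v \in nb B (r u) by rewrite (rP u).1 inE vB.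
  by rewrite inE => /andP[].
- by apply/subsetP => _ /imsetP[v _ ->]; case: (rP v).
- exact: leq_imset_card.
Qed.

(** The binomial coefficient on the left makes the induction go through: it counts the sets added in
    the next step, and 'C(b, i + 1) is at most b times 'C(b, i). *)
Lemma card_small_subsets (T : finType) (B : {set T}) i :
  #|[set A : {set T} | (A \subset B) && (#|A| < i)]| + 'C(#|B|, i) <=
    #|B|.+1 ^ i.
Proof.
elim: i => [|i IH].
  rewrite bin0 (_ : [set _ | _] = set0) ?cards0 //.
  by apply/setP => A; rewrite !inE andbF.
have sub : [set A : {set T} | (A \subset B) && (#|A| < i.+1)] \subset
    [set A : {set T} | (A \subset B) && (#|A| < i)] :|:
    [set A : {set T} | A \subset B & #|A| == i].
  by apply/subsetP => A; rewrite !inE ltnS leq_eqVlt -andb_orr orbC.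
have c1 := leq_trans (subset_leq_card sub) (leq_card_setU _ _).
rewrite cards_draws in c1.
have c2 : 'C(#|B|, i.+1) <= #|B| * 'C(#|B|, i).
    apply: leq_trans (leq_pmull _ (ltn0Sn i)) _.
    by rewrite mul_bin_left leq_mul2r leq_subr orbT.
rewrite expnS; move: (#|B|.+1 ^ i) 'C(#|B|, i) 'C(#|B|, i.+1) IH c1 c2.
set a := #|_|; set b := #|_|; set d := #|B|; move: a b d => a b d p x y.
by rewrite mulSn => IH; have := leq_mul (leqnn d) IH; rewrite mulnDr; lia.
Qed.

(** Representatives with fewer than i blue neighbours are determined by a small subset of B. Any
    other lies in [cn A] for some i-subset A of B, and each [cn A] has at most j - 1 elements. *)
Lemma card_kept i j B : 0 < j -> ~ has_subgraph (complete_bipartite i j) G ->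
  #|kept i B| <= #|B| + j * #|B|.+1 ^ i.
Proof.
move=> j0 free; pose R := [set v | first B v].
have subK : kept i B \subset B :|: R.
  apply/subsetP => v; rewrite !inE => /orP[-> // | /andP[_ ->]].
  by rewrite orbT.
apply: leq_trans (subset_leq_card subK) _.
apply: leq_trans (leq_card_setU _ _) _; rewrite leq_add2l.
pose R1 := [set v in R | #|nb B v| < i].
pose D := [set A : {set 'I_(nv G)} | (A \subset B) && (#|A| < i)].
pose E := [set A : {set 'I_(nv G)} | A \subset B & #|A| == i].
have subR : R \subset R1 :|: \bigcup_(A in E) cn A.
  apply/subsetP => v vR; rewrite inE [v \in R1]inE vR /=.
  have [//|/= iv] := ltnP.
  have : 0 < #|[set A : {set 'I_(nv G)} | A \subset nb B v & #|A| == i]|.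
    by rewrite cards_draws bin_gt0.
  move=> /card_gt0P[A]; rewrite inE => /andP[/subsetP Av Ai].
  apply/bigcupP; exists A.
    by rewrite inE Ai andbT; apply/subsetP => w /Av; rewrite inE => /andP[].
  rewrite inE; apply/forall_inP => u /Av.
  by rewrite inE adj_sym => /andP[].
have R1D : #|R1| <= #|D|.
  have inj : {in R1 &, injective (nb B)}.
    move=> u v; rewrite !inE => /andP[fu _] /andP[fv _] uv.
    have [lt | lt | /ord_inj //] := ltngtP u v.
      by have := implyP (forallP fv u) lt; rewrite uv eqxx.
    by have := implyP (forallP fu v) lt; rewrite uv eqxx.
  rewrite -(card_in_imset inj); apply: subset_leq_card.
  apply/subsetP => _ /imsetP[v + ->]; rewrite !inE => /andP[_ ->].
  by rewrite andbT; apply/subsetP => w; rewrite inE => /andP[].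
have cE : #|\bigcup_(A in E) cn A| <= 'C(#|B|, i) * j.-1.
  rewrite -cards_draws; apply: card_bigcup_le => A.
  rewrite inE => /andP[_ /eqP].
  exact: card_cn.
apply: leq_trans (subset_leq_card subR) _.
apply: leq_trans (leq_card_setU _ _) _.
have := card_small_subsets B i; rewrite -/D.
move: (_ ^ _) 'C(_, _) #|D| #|R1| R1D cE => p x d r rd cE dp.
have l1 : d <= j * d by rewrite leq_pmull.
have l2 : x * j.-1 <= j * x by rewrite mulnC leq_mul2r leq_pred orbT.
by have := leq_mul (leqnn j) dp; rewrite mulnDr; lia.
Qed.

End Reduction.

(** * The output graph *)

Lemma nat_adjE (G : graph) (u v : 'I_(nv G)) : nat_adj G u v = adj u v.
Proof. by rewrite /nat_adj !valK. Qed.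

Section Output.

Variables (G : graph) (B K : {set 'I_(nv G)}).

Let q := #|K|.

Definition oldv (a : nat) : nat := nth 0 [seq val v | v <- enum K] a.

(** One rule gives both edges of a path: from a to a + q unless a is a blue copy, and from a + q to
    a + 2q always. *)
Definition pendant (a b : nat) : bool :=
  (b == a + q) && ~~ ((a < q) && (oldv a \in [seq val v | v <- enum B])).

(* The vertex a < q is a copy of oldv a; if it need not be dominated, it is   *)
(* attached to the path a + q, a + 2q, and otherwise this path is a component.*)
Definition out_adj (a b : nat) : bool :=
  [|| [&& a < q, b < q & nat_adj G (oldv a) (oldv b)],
      pendant a b | pendant b a].

(* For i = 1 the pendant paths could create a K_{1,j}.                         *)
Definition out_nv (i : nat) : nat := if i == 1 then q else q + q + q.

Definition out_k (i k : nat) : nat := if i == 1 then k else k + q.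

Let L (x : 'I_q) : 'I_(nv G) := enum_val x.

Lemma oldvE (x : 'I_q) : oldv x = L x.
Proof.
rewrite /oldv (nth_map (L x)) -?cardE //.
by rewrite -enum_val_nth.
Qed.

Lemma mem_old (v : 'I_(nv G)) :
  (val v \in [seq val v | v <- enum B]) = (v \in B).
Proof. by rewrite (mem_map val_inj) mem_enum. Qed.

Lemma L_inj : injective L. Proof. exact: enum_val_inj. Qed.

Lemma L_surj v : v \in K -> exists x, v = L x.
Proof. by move=> vK; exists (enum_rank_in vK v); rewrite /L enum_rankK_in. Qed.

Variable H : graph.

Hypothesis adjH : forall a b : 'I_(nv H), adj a b = out_adj a b.

Section Copies.

Hypothesis qH : q <= nv H.

Definition copy (x : 'I_q) : 'I_(nv H) := widen_ord qH x.

Lemma adj_copy x y : adj (copy x) (copy y) = adj (L x) (L y).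
Proof.
rewrite adjH /out_adj /pendant /= !ltn_ord /= !oldvE nat_adjE.
by have := ltn_ord x; have := ltn_ord y; case: (adj _ _) => //=; lia.
Qed.

Lemma copy_inj : injective copy.
Proof. by move=> x y /(congr1 val) /= ?; apply: ord_inj. Qed.

Lemma subgraph_of_copies (F : graph) (f : 'I_(nv F) -> 'I_(nv H)) :
  injective f -> (forall u v, adj u v -> adj (f u) (f v)) ->
  (forall u, f u < q) -> has_subgraph F G.
Proof.
move=> f_inj f_adj fq; pose g u := Ordinal (fq u).
have gE u : f u = copy (g u) by apply: val_inj.
exists (L \o g); split=> [u v /L_inj uv | u v /f_adj].
  by apply: f_inj; rewrite !gE uv.
by rewrite !gE adj_copy.
Qed.

End Copies.

Section OneJ.

Hypotheses (nH : nv H = q) (KB : K = B).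

Lemma out_free1 F : has_subgraph F H -> has_subgraph F G.
Proof.
move=> [f [f_inj f_adj]].
have qH : q <= nv H by rewrite nH.
by apply: (subgraph_of_copies qH f_inj f_adj) => u; rewrite -nH ltn_ord.
Qed.

(** A vertex of a K_{1,j}-free graph dominates at most j vertices, itself included. So a
    yes-instance has at most k j vertices, B is everything, and the output is a copy of G.
    Conversely, k vertices that dominate B dominate G by soundness. *)
Lemma out_yes1 j k : 0 < j -> ~ has_subgraph (complete_bipartite 1 j) G ->
  (forall S : {set 'I_(nv G)}, #|S| <= k ->
    dominates S B -> dominates S setT) ->
  (nv G <= k * j -> B = setT) ->
  (exists2 S : {set 'I_(nv G)}, dominating S & #|S| <= k) <->
  (exists2 S : {set 'I_(nv H)}, dominating S & #|S| <= k).
Proof.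
move=> j0 free sound full.
have qH : q <= nv H by rewrite nH.
split=> [[S dS Sk] | [S dS Sk]].
  have KT : K = setT.
    rewrite KB; apply: full.
    move/dominating_dominates: dS => /subset_leq_card.
    rewrite cardsT card_ord => dS; apply: leq_trans dS _.
    apply: leq_trans (leq_mul Sk (leqnn j)).
    apply: card_bigcup_le => u _.
    have -> : cl u = u |: cn [set u].
      apply/setP => w; rewrite !inE; congr (_ || _).
      by apply/idP/forall_inP => [uw v /set1P-> // | ->]; rewrite ?inE.
    rewrite cardsU1.
    apply: leq_trans (leq_add (leq_b1 _) (card_cn j0 free (cards1 u))) _.
    by rewrite add1n prednK.
  exists [set copy qH x | x in [set x | L x \in S]]; last first.
    apply: leq_trans (leq_imset_card _ _) _; apply: leq_trans Sk.
    rewrite -(card_imset _ L_inj); apply: subset_leq_card.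
    by apply/subsetP => _ /imsetP[x + ->]; rewrite inE.
  move=> v vS.
  have vq : v < q by rewrite -nH ltn_ord.
  have ve : v = copy qH (Ordinal vq) by apply: val_inj.
  have LS : L (Ordinal vq) \notin S.
    by apply: contra vS => vS; rewrite ve imset_f ?inE.
  have [u uS uv] := dS _ LS.
  have [x ux] : exists x, u = L x by apply: L_surj; rewrite KT inE.
  exists (copy qH x); first by rewrite imset_f // inE -ux.
  by rewrite ve adj_copy -ux.
have c x : exists y, x = copy qH y.
  have xq : x < q by rewrite -nH ltn_ord.
  by exists (Ordinal xq); apply: val_inj.
exists [set L x | x in [set x | copy qH x \in S]]; last first.
  apply: leq_trans (leq_imset_card _ _) _; apply: leq_trans Sk.
  rewrite -(card_imset _ (@copy_inj qH)); apply: subset_leq_card.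
  by apply/subsetP => _ /imsetP[x + ->]; rewrite inE.
apply/dominating_dominates/sound.
  apply: leq_trans (leq_imset_card _ _) _; apply: leq_trans Sk.
  rewrite -(card_imset _ (@copy_inj qH)); apply: subset_leq_card.
  by apply/subsetP => _ /imsetP[x + ->]; rewrite inE.
apply/dominatesP => v vB vS.
have [x vx] : exists x, v = L x by apply: L_surj; rewrite KB.
have xS : copy qH x \notin S.
  by apply: contra vS => xS; rewrite vx imset_f ?inE.
have [u uS ux] := dS _ xS; have [y uy] := c u.
exists (L y); first by rewrite imset_f // inE -uy.
by rewrite vx -(adj_copy qH) -uy.
Qed.

End OneJ.

Section Gadget.

Hypothesis nH : nv H = q + q + q.

Fact q_le_nvH : q <= nv H. Proof. by rewrite nH; lia. Qed.

Let e0 := copy q_le_nvH.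

Fact e1_proof (x : 'I_q) : x + q < nv H.
Proof. by have := ltn_ord x; rewrite nH; lia. Qed.

Let e1 x := Ordinal (e1_proof x).

Fact e2_proof (x : 'I_q) : x + q + q < nv H.
Proof. by have := ltn_ord x; rewrite nH; lia. Qed.

Let e2 x := Ordinal (e2_proof x).

Lemma out_cases (P : 'I_(nv H) -> Prop) :
  (forall x, P (e0 x)) -> (forall x, P (e1 x)) -> (forall x, P (e2 x)) ->
  forall u, P u.
Proof.
move=> h0 h1 h2 u; have un : u < q + q + q by rewrite -nH.
have [uq | uq] := ltnP u q.
  by rewrite (_ : u = e0 (Ordinal uq)) //; apply: val_inj.
have [uq2 | uq2] := ltnP u (q + q).
  have p : u - q < q by lia.
  by rewrite (_ : u = e1 (Ordinal p)) //; apply: val_inj => /=; lia.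
have p : u - q - q < q by lia.
by rewrite (_ : u = e2 (Ordinal p)) //; apply: val_inj => /=; lia.
Qed.

Lemma adj01 x y : adj (e0 x) (e1 y) = (x == y) && (L x \notin B).
Proof.
rewrite adjH /out_adj /pendant /= oldvE mem_old -val_eqE /=.
by have := ltn_ord x; have := ltn_ord y; case: (L x \in B); lia.
Qed.

Lemma adj02 x y : adj (e0 x) (e2 y) = false.
Proof.
rewrite adjH /out_adj /pendant /=.
by have := ltn_ord x; have := ltn_ord y; lia.
Qed.

Lemma adj11 x y : adj (e1 x) (e1 y) = false.
Proof.
rewrite adjH /out_adj /pendant /=.
by have := ltn_ord x; have := ltn_ord y; lia.
Qed.

Lemma adj12 x y : adj (e1 x) (e2 y) = (x == y).
Proof.
rewrite adjH /out_adj /pendant /= -val_eqE /=.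
by have := ltn_ord x; have := ltn_ord y; lia.
Qed.

Lemma adj22 x y : adj (e2 x) (e2 y) = false.
Proof.
rewrite adjH /out_adj /pendant /=.
by have := ltn_ord x; have := ltn_ord y; lia.
Qed.

Lemma e0_inj : injective e0. Proof. exact: copy_inj. Qed.

Lemma e2_nbr x u : adj u (e2 x) -> u = e1 x.
Proof.
elim/out_cases: u => y; rewrite ?adj02 ?adj12 ?adj22 //.
by move/eqP->.
Qed.

Lemma e1_nbr x u : adj u (e1 x) -> u = e0 x \/ u = e2 x.
Proof.
elim/out_cases: u => y; rewrite ?adj01 ?adj11 //.
  by case/andP=> /eqP->; left.
by rewrite adj_sym adj12 => /eqP->; right.
Qed.

(** Every vertex of K_{i,j} has two neighbours here. This excludes the path ends [e2], and then the
    middles [e1], which have at most one neighbour besides their end. *)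
Lemma out_free2 i j : 1 < i -> 1 < j ->
  has_subgraph (complete_bipartite i j) H ->
  has_subgraph (complete_bipartite i j) G.
Proof.
move=> i1 j1 [f [f_inj f_adj]].
have deg2 (u : 'I_(i + j)) : exists v w : 'I_(i + j),
    [/\ v <> w, @adj (complete_bipartite i j) v u &
        @adj (complete_bipartite i j) w u].
  case: (ltnP u i) => ui.
    have p0 : i < i + j by lia.
    have p1 : i.+1 < i + j by lia.
    exists (Ordinal p0), (Ordinal p1); rewrite /= /Kadj /= ui ltnn.
    by split=> //; [case; lia | rewrite ltnNge leqnSn].
  have p0 : 0 < i + j by lia.
  have p1 : 1 < i + j by lia.
  exists (Ordinal p0), (Ordinal p1).
  by rewrite /= /Kadj /= [u < i]ltnNge ui /= i1 ltnW.
have no2 u x : f u <> e2 x.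
  have [v [w [vw vu wu]]] := deg2 u; move=> ux.
  move/f_adj: vu; move/f_adj: wu; rewrite ux => /e2_nbr we /e2_nbr ve.
  by apply/vw/f_inj; rewrite ve we.
have no1 u x : f u <> e1 x.
  have [v [w [vw vu wu]]] := deg2 u; move=> ux.
  move/f_adj: vu; move/f_adj: wu; rewrite ux.
  move=> /e1_nbr[we | /no2 //] /e1_nbr[ve | /no2 //].
  by apply/vw/f_inj; rewrite ve we.
apply: (subgraph_of_copies q_le_nvH f_inj f_adj) => u.
have := no1 u; have := no2 u; elim/out_cases: (f u) => x n2 n1.
- exact: (ltn_ord x).
- by case: (n1 x).
- by case: (n2 x).
Qed.

(** All q middles are added to a solution for B: they dominate the paths and the non-blue copies.
    Conversely, each path end costs one vertex of its path, leaving k for the copies; a blue copy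
    has only copies as neighbours. *)
Lemma out_yes2 k : B \subset K ->
  (exists S : {set 'I_(nv G)}, [/\ S \subset K, #|S| <= k & dominates S B]) <->
  (exists2 S : {set 'I_(nv H)}, dominating S & #|S| <= k + q).
Proof.
move=> BK; split=> [[S [SK Sk /dominatesP SB]] | [S dS Sk]].
  exists (e0 @: [set x | L x \in S] :|: e1 @: setT); last first.
    apply: leq_trans (leq_card_setU _ _) _; rewrite leq_add //; last first.
      by apply: leq_trans (leq_imset_card _ _) _; rewrite cardsT card_ord.
    apply: leq_trans (leq_imset_card _ _) _; apply: leq_trans Sk.
    rewrite -(card_imset _ L_inj); apply: subset_leq_card.
    by apply/subsetP => _ /imsetP[x + ->]; rewrite inE.
  have e1S x : e1 x \in e0 @: [set x | L x \in S] :|: e1 @: setT.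
    by rewrite inE imset_f ?orbT ?inE.
  elim/out_cases => x; last 2 first.
  - by rewrite e1S.
  - by move=> _; exists (e1 x); rewrite ?adj12.
  rewrite inE negb_or => /andP[xS _].
  have [xB | xB] := boolP (L x \in B); last first.
    by exists (e1 x); rewrite // adj_sym adj01 eqxx.
  have LxS : L x \notin S by apply: contra xS => xS; rewrite imset_f ?inE.
  have [u uS ux] := SB _ xB LxS; have [y uy] := L_surj (subsetP SK u uS).
  exists (e0 y); first by rewrite inE imset_f // inE -uy.
  by rewrite adj_copy -/L -uy.
pose S0 := [set x | e0 x \in S].
exists (L @: S0); split.
- by apply/subsetP => _ /imsetP[x _ ->]; apply: enum_valP.
(* To dominate [e2 x], the set S contains [e2 x] or its only neighbour [e1 x]; g chooses one. *)
- pose g x := if e1 x \in S then e1 x else e2 x.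
  have gS x : g x \in S.
    rewrite /g; case: ifPn => // x1; apply: contraR x1 => /dS[u uS /e2_nbr ux].
    by rewrite -ux.
  have g_inj : injective g.
    move=> x y; have := ltn_ord x; have := ltn_ord y; rewrite /g => yq xq.
    by case: ifP => _; case: ifP => _ /(congr1 val) /= xy; apply: ord_inj; lia.
  have dis : [disjoint e0 @: S0 & g @: setT].
    apply/pred0P => u /=; apply/negP => /andP[/imsetP[x _ ->] /imsetP[y _]].
    by have := ltn_ord x; rewrite /g; case: ifP => _ xq /(congr1 val) /=; lia.
  have sub : e0 @: S0 :|: g @: setT \subset S.
    apply/subsetP => u; rewrite inE => /orP[] /imsetP[x xS ->] //.
    by rewrite inE in xS.
  (* The equality case of [leq_card_setU] turns disjointness into additivity of cardinals. *)
  have := subset_leq_card sub; rewrite -(leq_card_setU _ _) in dis.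
  rewrite (eqP dis) (card_imset _ g_inj) cardsT card_ord (card_imset _ e0_inj).
  rewrite (card_imset _ L_inj) => le; rewrite -(leq_add2r q).
  exact: leq_trans Sk.
- apply/dominatesP => v vB vS.
  have [x vx] := L_surj (subsetP BK v vB).
  have xS : e0 x \notin S.
    by apply: contra vS => xS; rewrite vx imset_f ?inE.
  have [u uS] := dS _ xS; elim/out_cases: u uS => y yS.
  + rewrite adj_copy -/L => yx; exists (L y); first by rewrite imset_f ?inE.
    by rewrite vx.
  + by rewrite adj_sym adj01 -vx vB andbF.
  + by rewrite adj_sym adj02.
Qed.

End Gadget.

End Output.

(** * The program *)

Local Notation "c1 ;; c2" := (Seq c1 c2) (at level 60, right associativity).

(* Array 0 is the input and output matrix; ADJ is a copy of the input, and ROW *)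
(* holds the multiples of nv G, as there is no multiplication. BLUE and INX    *)
(* are characteristic functions, of B and of the set X of the search.          *)
(* Registers from 20 on are the loop counters of the nested loops of search,   *)
(* registers 2 to 8 are scratch.                                               *)
Local Notation ROW := 1 (only parsing).
Local Notation BLUE := 2 (only parsing).
Local Notation INX := 3 (only parsing).
Local Notation THR := 4 (only parsing).
Local Notation LIST := 5 (only parsing).
Local Notation ADJ := 6 (only parsing).

Definition incr (x : nat) : cmd := Assign x (Plus (Reg x) (Const 1)).

Definition neq (e1 e2 : expr) : expr := Plus (Minus e1 e2) (Minus e2 e1).

Definition entry (e1 e2 : expr) : expr := Read ADJ (Plus (Read ROW e1) e2).

(* The parameter, written in binary, may be too large for a loop; instances    *)
(* with nv G < k are yes-instances anyway.                                     *)
Definition init_k : cmd :=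
  If (Minus (Reg 1) (Reg 0)) (Assign 1 (Plus (Reg 0) (Const 1))) Skip.

Definition load : cmd :=
  Assign 2 (Const 0) ;;
  For 3 (Reg 0)
    (Write ROW (Reg 3) (Reg 2) ;;
     Write BLUE (Reg 3) (Const 1) ;;
     For 4 (Reg 0) (Write ADJ (Reg 2) (Read 0 (Reg 2)) ;; incr 2)).

(** The recursion of [thr], with the product by k as repeated addition. *)
Definition thresholds (i j : nat) : cmd :=
  Write THR (Const 0) (Const j.-1) ;;
  For 3 (Const i)
    (Write THR (Plus (Reg 3) (Const 1)) (Const 1) ;;
     For 2 (Reg 1)
       (Write THR (Plus (Reg 3) (Const 1))
         (Plus (Read THR (Plus (Reg 3) (Const 1)))
               (Plus (Read THR (Reg 3)) (Const 1))))).

(** Register 5 counts the blue common neighbours of X retained so far; those met after it has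
    reached the threshold lose their colour. *)
Definition cap (s : nat) : cmd :=
  Assign 5 (Const 0) ;;
  For 2 (Reg 0)
    (If (Read BLUE (Reg 2))
      (Assign 4 (Const 1) ;;
       For 3 (Reg 0)
         (If (Read INX (Reg 3))
           (If (entry (Reg 3) (Reg 2)) Skip (Assign 4 (Const 0)))
           Skip) ;;
       If (Reg 4)
         (If (Minus (Read THR (Const s)) (Reg 5))
           (incr 5) (Write BLUE (Reg 2) (Const 0)))
         Skip)
      Skip).

(** For want of procedures, the recursion over X is unrolled into nested loops, each depth with its
    own counter. A set may be met once per order of its elements, which is harmless since [reduced]
    allows any initial blue set. *)
Fixpoint search (s : nat) : cmd :=
  if s is s'.+1 then
    For (20 + s') (Reg 0)
      (If (Read INX (Reg (20 + s'))) Skip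
        (Write INX (Reg (20 + s')) (Const 1) ;;
         search s' ;;
         Write INX (Reg (20 + s')) (Const 0))) ;;
    cap s
  else Skip.

Definition compare_nb : cmd :=
  Assign 6 (Const 0) ;;
  For 7 (Reg 0)
    (If (Read BLUE (Reg 7))
      (If (neq (entry (Reg 3) (Reg 7)) (entry (Reg 2) (Reg 7)))
        (Assign 6 (Const 1)) Skip)
      Skip).

(* Const i.-1 is the truth value of 1 < i.                                     *)
Definition collect (i : nat) : cmd :=
  Assign 5 (Const 0) ;;
  For 2 (Reg 0)
    (If (Read BLUE (Reg 2))
      (Assign 4 (Const 1))
      (Assign 4 (Const i.-1) ;;
       For 3 (Reg 2)
         (compare_nb ;; If (Reg 6) Skip (Assign 4 (Const 0)))) ;;
     If (Reg 4) (Write LIST (Reg 5) (Reg 2) ;; incr 5) Skip).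

Definition put_pendant (x y : nat) : cmd :=
  If (neq (Reg y) (Plus (Reg x) (Reg 5))) Skip
    (If (Minus (Reg 5) (Reg x))
      (If (Read BLUE (Read LIST (Reg x))) Skip (Assign 6 (Const 1)))
      (Assign 6 (Const 1))).

Definition put_entry : cmd :=
  Assign 6 (Const 0) ;;
  If (Minus (Reg 5) (Reg 3))
    (If (Minus (Reg 5) (Reg 4))
      (Assign 6 (entry (Read LIST (Reg 3)) (Read LIST (Reg 4)))) Skip)
    Skip ;;
  put_pendant 3 4 ;;
  put_pendant 4 3 ;;
  Write 0 (Reg 2) (Reg 6) ;;
  incr 2.

Definition sizes (i : nat) : cmd :=
  if i == 1 then Assign 8 (Reg 5)
  else Assign 8 (Plus (Plus (Reg 5) (Reg 5)) (Reg 5)) ;;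
       Assign 1 (Plus (Reg 1) (Reg 5)).

Definition emit : cmd :=
  Assign 2 (Const 0) ;;
  For 3 (Reg 8) (For 4 (Reg 8) put_entry) ;;
  Assign 0 (Reg 8).

Definition kernel (i j : nat) : cmd :=
  init_k ;; load ;; thresholds i j ;; search i ;; collect i ;; sizes i ;; emit.

(** * Correctness of the program *)

Lemma unch_reg c s s' x : unch c s s' -> x \notin modr c -> reg s' x = reg s x.
Proof. by case=> r _; apply: r. Qed.

Lemma unch_arr c s s' a l :
  unch c s s' -> a \notin moda c -> arr s' a l = arr s a l.
Proof. by case=> _; apply. Qed.

Lemma load_run m n s : n <= m -> reg s 0 = n ->
  run m load s (fun s' =>
    [/\ forall v, v < n -> arr s' ROW v = v * n,
        forall v, v < n -> arr s' BLUE v = 1 &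
        forall p, p < n * n -> arr s' ADJ p = arr s 0 p]).
Proof.
move=> nm s0; apply/run_seq/run_assign => /= _.
set s1 := set_reg _ _ _.
pose I a (s' : store) := [/\ reg s' 2 = a * n,
  forall v, v < a -> arr s' ROW v = v * n,
  forall v, v < a -> arr s' BLUE v = 1 &
  forall p, p < a * n -> arr s' ADJ p = arr s 0 p].
apply: (@run_for _ _ _ _ _ n I) => //.
- by move=> s' U /=; rewrite (unch_reg U).
- move=> a s2 an U2 x2 [r2 row2 blue2 adj2].
  apply/run_seq/run_write => /= _; apply/run_seq/run_write => /= _.
  set s3 := set_arr _ _ _ _.
  pose J b (s' : store) := reg s' 2 = a * n + b /\
    forall p, p < a * n + b -> arr s' ADJ p = arr s 0 p.
  apply: (@run_for _ _ _ _ _ n J) => //.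
  + by move=> s' U /=; rewrite (unch_reg U) //= (unch_reg U2).
  + by rewrite /J addn0.
  + move=> b s4 bn U4 x4 [r4 adj4].
    apply/run_seq/run_write => /= _; apply/run_assign; split=> /=.
      by rewrite r4 addn1 addnS.
    move=> p; rewrite addnS ltnS leq_eqVlt r4 => /orP[/eqP-> | pl].
      by rewrite eqxx (unch_arr _ U4) //= (unch_arr _ U2).
    by rewrite ltn_eqF // adj4.
  + move=> s4 U4 [r4 adj4]; rewrite /I mulSn addnC r4.
    split=> //.
    * move=> v; rewrite ltnS leq_eqVlt (unch_arr _ U4) //= x2 r2.
      by case: eqP => [-> // | _ /= va]; rewrite row2.
    * move=> v; rewrite ltnS leq_eqVlt (unch_arr _ U4) //= x2.
      by case: eqP => [-> // | _ /= va]; rewrite blue2.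
- by move=> s' _ [].
Qed.

Lemma thresholds_run m i j k s : i <= m -> k <= m -> reg s 1 = k ->
  run m (thresholds i j) s (fun s' =>
    forall t, t <= i -> arr s' THR t = thr j k t).
Proof.
move=> im km s1; apply/run_seq/run_write => /= _.
set s2 := set_arr _ _ _ _.
pose I a (s' : store) := forall t, t <= a -> arr s' THR t = thr j k t.
apply: (@run_for _ _ _ _ _ i I) => //.
- by move=> t; rewrite leqn0 => /eqP->.
- move=> a s3 ai U3 x3 I3; apply/run_seq/run_write => /= _.
  set s4 := set_arr _ _ _ _.
  pose J b (s' : store) := arr s' THR a.+1 = b * (thr j k a).+1 + 1 /\
    forall t, t <= a -> arr s' THR t = thr j k t.
  apply: (@run_for _ _ _ _ _ k J) => //.
  + by move=> s' U /=; rewrite (unch_reg U) //= (unch_reg U3).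
  + split=> [|t ta] /=; first by rewrite x3 addn1 eqxx mul0n.
    by rewrite x3 addn1 ltn_eqF ?ltnS // I3.
  + move=> b s5 bk U5 x5 [J5 I5]; apply: run_write.
    have r3 : reg s5 3 = a by rewrite (unch_reg U5).
    split=> [|t ta] /=; rewrite r3 addn1.
      by rewrite eqxx J5 I5 // mulSn; lia.
    by rewrite ltn_eqF ?ltnS // I5.
  + move=> s5 U5 [J5 I5] t; rewrite leq_eqVlt => /orP[/eqP-> // | ta].
    exact: I5.
Qed.

(** For a variable depth [modr] does not compute, so the frame conditions need an explicit bound. *)
Lemma modr_search t (x : nat) :
  x \in modr (search t) -> 2 <= x <= 5 \/ 20 <= x < 20 + t.
Proof.
elim: t => [|t IH] //; rewrite /= !(mem_cat, inE, in_nil) => h.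
have [/IH[xt | xt] | n] := boolP (x \in modr (search t)).
- by left.
- by right; lia.
- by move: h; rewrite (negPf n); lia.
Qed.

Lemma moda_search t (a : nat) : a \in moda (search t) -> a = BLUE \/ a = INX.
Proof.
elim: t => [|t IH] //=; rewrite !(mem_cat, inE, in_nil) => h.
have [/IH // | n] := boolP (a \in moda (search t)).
rewrite (negPf n) in h; lia.
Qed.

(** * Correctness of the search that shrinks the blue set *)

Section Search.

Variables (G : graph) (i j k m : nat).

Hypothesis nm : nv G <= m.

Implicit Types (u v w : 'I_(nv G)) (B X : {set 'I_(nv G)}).

Definition matrix (s : store) : Prop :=
  (forall v, arr s ROW v = v * nv G) /\
  (forall u v, arr s ADJ (u * nv G + v) = adj u v).

Lemma matrix_unch c s s' : all (fun a => a \notin moda c) [:: ROW; ADJ] ->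
  unch c s s' -> matrix s -> matrix s'.
Proof.
move=> /and3P[cr ca _] U [sr sa].
by split=> [v | u v]; rewrite (unch_arr _ U).
Qed.

Lemma eval_entry s e1 e2 u v : matrix s ->
  eval s e1 = u -> eval s e2 = v -> eval s (entry e1 e2) = adj u v.
Proof. by move=> [sr sa] /= -> ->; rewrite sr sa. Qed.

Definition context (s : store) : Prop :=
  [/\ reg s 0 = nv G, reg s 1 = k, matrix s &
      forall t, t <= i -> arr s THR t = thr j k t].

Lemma context_unch c s s' :
  all (fun x => x \notin modr c) [:: 0; 1] ->
  all (fun a => a \notin moda c) [:: ROW; THR; ADJ] ->
  unch c s s' -> context s -> context s'.
Proof.
move=> /and3P[c0 c1 _] /and4P[cr ct ca _] U [s0 s1 sm st]; split.
- by rewrite (unch_reg U).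
- by rewrite (unch_reg U).
- by apply: matrix_unch U sm; rewrite /= cr ca.
- by move=> t ti; rewrite (unch_arr _ U) // st.
Qed.

Definition holds (s : store) (a : nat) X : Prop :=
  forall v, arr s a v = (v \in X).

Lemma holds_set s a v (b : bool) X : holds s a X ->
  holds (set_arr s a v b) a (if b then v |: X else X :\ v).
Proof.
move=> sX w /=; rewrite eqxx /= sX val_eqE.
by case: b; rewrite !inE; case: eqP.
Qed.

Lemma holds_unch c s s' a X : unch c s s' -> a \notin moda c ->
  holds s a X -> holds s' a X.
Proof. by move=> U ac sX v; rewrite (unch_arr _ U). Qed.

Lemma card_below_step X v :
  #|[set w in X | w < v.+1]| = (v \in X) + #|[set w in X | w < v]|.
Proof.
rewrite -[(v \in X) : nat](_ : #|[set w in X | w == v]| = _); last first.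
  have [vX | vX] := boolP (v \in X).
    rewrite (_ : [set _ in _ | _] = [set v]) ?cards1 //.
    by apply/setP => w; rewrite !inE; case: eqP => [-> | _]; rewrite ?vX ?andbF.
  rewrite (_ : [set _ in _ | _] = set0) ?cards0 //.
  apply/setP => w; rewrite !inE; case: eqP => [-> | _]; last by rewrite andbF.
  by rewrite (negPf vX).
set A := [set w in X | w == v]; set C := [set w in X | w < v].
have /eqP <- : #|A :|: C| == #|A| + #|C|.
  rewrite (leq_card_setU A C); apply/pred0P => w /=; rewrite !inE.
  by case: eqP => [-> | _]; rewrite ?ltnn ?andbF.
apply: eq_card => w; rewrite !inE ltnS leq_eqVlt val_eqE.
by case: (w \in X).
Qed.

Lemma cap_run t s X B : t <= i -> context s -> holds s INX X ->
  holds s BLUE B ->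
  run m (cap t) s (fun s' => exists B',
    [/\ holds s' BLUE B', B' \subset B, B :\: B' \subset cn X,
        #|B' :&: cn X| <= thr j k t &
        B' = B \/ #|B' :&: cn X| = thr j k t]).
Proof.
move=> ti ctx sX sB; apply/run_seq/run_assign => /= _.
set s1 := set_reg _ _ _.
pose C B' a := #|[set w in B' :&: cn X | w < a]|.
(* Nothing is removed until the count C has reached the threshold, where it then stays. *)
pose I a (s' : store) := exists B', [/\ holds s' BLUE B', B' \subset B,
    B :\: B' \subset cn X, reg s' 5 = C B' a /\ C B' a <= thr j k t &
    B' = B \/ C B' a = thr j k t].
apply: (@run_for _ _ _ _ _ (nv G) I) => //.
- by move=> s' U /=; rewrite (unch_reg U) //; case: ctx.
- exists B; split=> //; last by left.
    by rewrite setDv sub0set.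
  rewrite /C (_ : [set _ in _ | _] = set0) ?cards0 //.
  by apply/setP => w; rewrite !inE andbF.
- move=> a s2 an U2 x2 [B2 [sB2 B2B cut2 [r2 c2] full2]].
  pose v := Ordinal an.
  have ctx2 : context s2 by apply: context_unch U2 _.
  have cS : C B2 a.+1 = ((v \in B2) && (v \in cn X)) + C B2 a.
    by rewrite /C (card_below_step _ v) inE.
  have keep s' : holds s' BLUE B2 -> reg s' 5 = C B2 a.+1 ->
      C B2 a.+1 <= thr j k t -> B2 = B \/ C B2 a = thr j k t -> I a.+1 s'.
    move=> sB' r' c' f'; exists B2; split=> //.
    case: f' => [-> | f']; [by left | right].
    by apply/eqP; rewrite eqn_leq c' -f' cS leq_addl.
  apply: run_if => /=; rewrite x2 (sB2 v); last first.
    move=> vB; apply: run_skip; have vC : C B2 a.+1 = C B2 a.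
      by rewrite cS; case: (v \in B2) vB.
    by apply: keep => //; rewrite vC.
  rewrite eqb0 negbK => vB; apply/run_seq/run_assign => /= _.
  set s3 := set_reg _ _ _.
  apply: run_seq.
  pose J b (s' : store) :=
    reg s' 4 = [forall u in X, (u < b) ==> adj u v] :> nat.
  apply: (@run_for _ _ _ _ _ (nv G) J) => //.
  + by move=> s' U /=; rewrite (unch_reg U) //=; case: ctx2.
  + by rewrite /J; apply/esym/eqP; rewrite eqb1; apply/forall_inP.
  + move=> b s4 bn U4 x4 J4; pose u := Ordinal bn.
    have ctx4 : context s4 by apply: context_unch U4 _.
    have JS : [forall w in X, (w < b.+1) ==> adj w v] =
        ((u \in X) ==> adj u v) && [forall w in X, (w < b) ==> adj w v].
      apply/forall_inP/andP => [h | [hu /forall_inP h] w wX].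
        split; first by apply/implyP => uX; have := h u uX; rewrite leqnn.
        apply/forall_inP => w wX; apply/implyP => wb.
        by have := h w wX; rewrite ltnS (ltnW wb).
      apply/implyP; rewrite ltnS leq_eqVlt => /orP[/eqP wb | wb].
        by rewrite (_ : w = u) in wX *; [exact: (implyP hu) | apply: val_inj].
      exact: (implyP (h w wX)).
    have X4 : arr s4 INX b = (u \in X).
      by rewrite (unch_arr _ U4) //= (unch_arr _ U2) //= (sX u).
    have E4 : eval s4 (entry (Reg 3) (Reg 2)) = adj u v.
      by apply: eval_entry; [case: ctx4 | | rewrite /= (unch_reg U4)].
    apply: run_if => /=; rewrite x4 X4.
      rewrite eqb0 negbK => uX; apply: run_if; rewrite E4.
        rewrite eqb0 negbK => uv; apply: run_skip.
        by rewrite /J JS uX uv.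
      move=> uv; apply: run_assign; rewrite /J JS uX /=.
      by case: (adj u v) uv.
    move=> uX; apply: run_skip; rewrite /J JS.
    by case: (u \in X) uX.
  + move=> s4 U4 J4 _.
    have r4 : reg s4 4 = (v \in cn X).
      rewrite J4 inE; congr nat_of_bool; apply: eq_forallb_in => u _.
      by rewrite ltn_ord.
    have sB4 : holds s4 BLUE B2 by apply: holds_unch U4 _ _.
    have r5 : reg s4 5 = C B2 a by rewrite (unch_reg U4).
    have x4 : reg s4 2 = a by rewrite (unch_reg U4).
    have thr4 : arr s4 THR t = thr j k t.
      by case: ctx => _ _ _ h; rewrite (unch_arr _ U4) //= (unch_arr _ U2) ?h.
    apply: run_if => /=; rewrite r4; last first.
      move=> vX; apply: run_skip; have vC : C B2 a.+1 = C B2 a.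
        by rewrite cS; case: (v \in cn X) vX; rewrite ?andbF.
      by apply: keep; rewrite ?vC.
    rewrite eqb0 negbK => vX; rewrite vB vX /= add1n in cS.
    apply: run_if => /=; rewrite thr4 r5; last move/eqP;
      rewrite subn_eq0 => lt.
      rewrite -ltnNge in lt; apply: run_assign.
      by apply: keep; rewrite ?cS /= ?r5 ?addn1 //.
    have {}lt : C B2 a = thr j k t.
      by apply/eqP; rewrite eqn_leq c2 lt.
    apply: run_write; rewrite [eval s4 (Reg 2)]/= x4.
    have CB : C (B2 :\ v) a.+1 = C B2 a.
      rewrite /C (card_below_step _ v) !inE eqxx /= add0n.
      apply: eq_card => w; rewrite !inE -val_eqE /=.
      by case: ltngtP; rewrite ?andbF.
    exists (B2 :\ v); split.
    * exact: (holds_set v false sB4).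
    * exact: subset_trans (subD1set _ _) B2B.
    * apply/subsetP => w; rewrite !inE negb_and negbK.
      case/andP=> /orP[/eqP-> _ | wB2 wB]; first by rewrite inE in vX.
      by have := subsetP cut2 w; rewrite !inE wB2 wB; apply.
    * by rewrite CB /= r5.
    * by right; rewrite CB.
- move=> s2 U2 [B2 [sB2 B2B cut2 [r2 c2] full2]].
  have CE : C B2 (nv G) = #|B2 :&: cn X|.
    by apply: eq_card => w; rewrite !inE ltn_ord andbT.
  by rewrite CE in c2 full2; exists B2; split.
Qed.

Lemma search_run t s X B : 0 < k -> 0 < j ->
  ~ has_subgraph (complete_bipartite i j) G -> #|X| + t = i ->
  context s -> holds s INX X -> holds s BLUE B ->
  run m (search t) s (fun s' => holds s' INX X /\
    exists2 B', holds s' BLUE B' & reduced j k t X B B').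
Proof.
move=> k0 j0 free; elim: t s X B => [|t IH] s X B Xt ctx sX sB.
  apply: run_skip; split=> //; exists B => //.
  by apply: reduced0 free _ => //; rewrite addn0 in Xt.
rewrite [search _]/=; set r := 20 + t; set loop := For _ _ _.
have rt : r \notin modr (search t) by apply/negP => /modr_search; lia.
have loopr x : x \in modr loop -> 2 <= x <= 5 \/ 20 <= x < 20 + t.+1.
  move=> xl; apply: (@modr_search t.+1).
  by rewrite -[modr _]/(modr loop ++ modr (cap t.+1)) mem_cat xl.
have loopa a : a \in moda loop -> a = BLUE \/ a = INX.
  move=> al; apply: (@moda_search t.+1).
  by rewrite -[moda _]/(moda loop ++ moda (cap t.+1)) mem_cat al.
have lctx s' : unch loop s s' -> context s'.
  move=> U; apply: context_unch U ctx.
    by apply/allP => x x01; apply/negP => /loopr; rewrite !inE in x01; lia.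
  by apply/allP => x x01; apply/negP => /loopa; rewrite !inE in x01; lia.
apply: run_seq.
pose I a s' := holds s' INX X /\
  exists2 B', holds s' BLUE B' & extended j k t X (fun b => b < a) B B'.
apply: (@run_for _ _ _ _ _ (nv G) I) => //.
- by rewrite /= cats0.
- by move=> s' /lctx[].
- by split=> //; exists B => //; apply: extended_refl.
- move=> a s1 an U1 x1 [sX1 [B1 sB1 ext1]]; pose v := Ordinal an.
  have ctx1 := lctx s1 U1.
  apply: run_if => /=; rewrite x1 (sX1 v).
    rewrite eqb0 negbK => vX; apply: run_skip; split=> //.
    exists B1 => //; apply: (extended_step (v := v)) ext1 _ _ => //.
    by rewrite vX.
  move=> vX; have {}vX : v \notin X by case: (v \in X) vX.
  apply/run_seq/run_write => /= _; rewrite x1; set s2 := set_arr _ _ _ _.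
  have sX2 : holds s2 INX (v |: X) by exact: (holds_set v true sX1).
  (* The inner search restores [INX] to [v |: X]; deleting v afterwards gives back X, since v was
     not in it. *)
  apply: run_seq; apply: run_mono (IH s2 (v |: X) B1 _ _ sX2 _) _ => //.
    by rewrite cardsU1 vX; lia.
  move=> s3 U3 [sX3 [B3 sB3 red3]] _; apply: run_write => /=.
  have -> : reg s3 r = val v by rewrite (unch_reg U3).
  split; first by have := holds_set v false sX3; rewrite /= setU1K.
  exists B3 => //; apply: (extended_step (v := v)) ext1 _ _ => //.
  by rewrite (negPf vX).
- move=> s1 U1 [sX1 [B1 sB1 ext1]] _; have ctx1 := lctx s1 U1.
  have ti : t.+1 <= i by lia.
  apply: run_mono (cap_run ti ctx1 sX1 sB1) _.
  move=> s2 U2 [B2 [sB2 B21 cut c2 full]].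
  split; first by apply: holds_unch U2 _ _.
  by exists B2 => //; apply: reducedS ext1 _ _ _ _.
Qed.

End Search.

(** * Collecting the kept vertices and writing the output matrix *)

Section Emit.

Variables (G : graph) (i m : nat) (B : {set 'I_(nv G)}).

Hypothesis nm : nv G <= m.

Implicit Types (u v w : 'I_(nv G)).

Let K := kept i B.

Lemma forall_below_step (P : pred 'I_(nv G)) v :
  [forall w : 'I_(nv G), (w < v.+1) ==> P w] =
    P v && [forall w : 'I_(nv G), (w < v) ==> P w].
Proof.
apply/forallP/andP => [h | [Pv /forallP h] w].
  split; first by have := h v; rewrite leqnn.
  apply/forallP => w; apply/implyP => wv.
  by have := h w; rewrite ltnS (ltnW wv).
apply/implyP; rewrite ltnS leq_eqVlt => /orP[/eqP/ord_inj-> // | wv].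
exact: implyP (h w) wv.
Qed.

Lemma neqE s e1 e2 : (eval s (neq e1 e2) == 0) = (eval s e1 == eval s e2).
Proof. by rewrite /= addn_eq0 !subn_eq0 -eqn_leq. Qed.

Lemma compare_nb_run j k s u v : context G i j k s -> holds s BLUE B ->
  reg s 2 = v -> reg s 3 = u ->
  run m compare_nb s
    (fun s' => (reg s' 6 == 0) = (nb B u == nb B v)).
Proof.
move=> ctx sB x2 x3; apply/run_seq/run_assign => /= _.
set s1 := set_reg _ _ _.
pose P w := (w \in B) ==> (adj u w == adj v w).
pose I a (s' : store) :=
  (reg s' 6 == 0) = [forall w : 'I_(nv G), (w < a) ==> P w].
apply: (@run_for _ _ _ _ _ (nv G) I) => //.
- by move=> s' U /=; rewrite (unch_reg U) //; case: ctx.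
- by rewrite /I; apply/esym/forallP.
- move=> a s2 an U2 x7 I2; pose w := Ordinal an.
  have ctx2 : context G i j k s2 by apply: context_unch U2 _.
  have sB2 : holds s2 BLUE B by apply: holds_unch U2 _ _.
  have [y2 y3] : reg s2 2 = v /\ reg s2 3 = u by rewrite !(unch_reg U2).
  rewrite /I (forall_below_step P w) /P.
  apply: run_if => /=; rewrite x7 (sB2 w); last first.
    by move=> wB; apply: run_skip; case: (w \in B) wB.
  rewrite eqb0 negbK => wB; rewrite wB /=.
  have mx2 : matrix G s2 by case: ctx2.
  have Eu := eval_entry (u := u) (v := w) (e1 := Reg 3) (e2 := Reg 7) mx2 y3 x7.
  have Ev := eval_entry (u := v) (v := w) (e1 := Reg 2) (e2 := Reg 7) mx2 y2 x7.
  apply: run_if => [|/eqP]; rewrite neqE Eu Ev => uv.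
    apply: run_assign => /=; move: uv.
    by case: (adj u w); case: (adj v w).
  apply: run_skip; rewrite I2; move: uv.
  by case: (adj u w); case: (adj v w).
- move=> s2 U2; rewrite /I => ->.
  apply/forallP/eqP => [h | uv w].
    apply/setP => w; have := h w; rewrite ltn_ord !inE /P /=.
    by case: (w \in B) => //= /eqP.
  rewrite ltn_ord /P /=; apply/implyP => wB; apply/eqP.
  by have := congr1 (fun A : {set 'I_(nv G)} => w \in A) uv; rewrite !inE wB.
Qed.

Definition listed (s : store) : Prop :=
  reg s 5 = #|K| /\ forall a, a < #|K| -> arr s LIST a = oldv K a.

(** [enum K] is increasing, hence it is the order in which [collect] finds the kept vertices. *)
Lemma kept_below :
  [seq a <- iota 0 (nv G) | a \in [seq val v | v <- enum K]] =
    [seq val v | v <- enum K].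
Proof.
rewrite -val_enum_ord filter_map; congr map.
have eK : enum K = [seq v <- enum 'I_(nv G) | v \in K] by rewrite enumT.
rewrite [RHS]eK; apply: eq_filter => v /=.
by rewrite (mem_map val_inj) mem_enum.
Qed.

Lemma collect_run j k s : context G i j k s -> holds s BLUE B ->
  run m (collect i) s listed.
Proof.
move=> ctx sB; apply/run_seq/run_assign => /= _.
set s1 := set_reg _ _ _.
pose l a := [seq b <- iota 0 a | b \in [seq val v | v <- enum K]].
pose I a (s' : store) := reg s' 5 = size (l a) /\
  forall b, b < size (l a) -> arr s' LIST b = nth 0 (l a) b.
apply: (@run_for _ _ _ _ _ (nv G) I) => //.
- by move=> s' U /=; rewrite (unch_reg U) //; case: ctx.
- move=> a s2 an U2 x2 [r2 l2]; pose v := Ordinal an.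
  have ctx2 : context G i j k s2 by apply: context_unch U2 _.
  have sB2 : holds s2 BLUE B by apply: holds_unch U2 _ _.
  have lS : l a.+1 = if v \in K then rcons (l a) a else l a.
    rewrite /l -addn1 iotaD filter_cat /= add0n.
    rewrite -[a]/(val v) (mem_map val_inj) mem_enum.
    by case: ifP => _; rewrite ?cats1 ?cats0.
  apply: (@run_seq _ _ _ _); apply: (@run_mono _ _ _
      (fun s' => (reg s' 4 != 0) = (v \in K))).
    apply: run_if => /=; rewrite x2 (sB2 v).
      rewrite eqb0 negbK => vB; apply: run_assign => /=.
      by rewrite /K inE vB.
    move=> vB; apply/run_seq/run_assign => /= _; set s3 := set_reg _ _ _.
    pose P u := nb B u != nb B v.
    pose J b (s' : store) :=
      (reg s' 4 != 0) = (1 < i) && [forall u : 'I_(nv G), (u < b) ==> P u].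
    have vK : (v \in K) = (1 < i) && [forall u : 'I_(nv G), (u < a) ==> P u].
      by rewrite /K inE; case: (v \in B) vB.
    apply: (@run_for _ _ _ _ _ a J) => //.
    + exact: leq_trans (ltnW an) nm.
    + by move=> s' U /=; rewrite (unch_reg U).
    + rewrite /J /= (_ : [forall _, _] = true) ?andbT; last exact/forallP.
      by case: (i) => [|[]].
    + move=> b s4 ba U4 x4 J4; pose u := Ordinal (ltn_trans ba an).
      have ctx4 : context G i j k s4 by apply: context_unch U4 _.
      have sB4 : holds s4 BLUE B by apply: holds_unch U4 _ _.
      have y2 : reg s4 2 = v by rewrite (unch_reg U4).
      have y3 : reg s4 3 = u by [].
      apply: run_seq; apply: run_mono (compare_nb_run ctx4 sB4 y2 y3) _.
      move=> s5 U5 e5 _; have J5 : (reg s5 4 != 0) = (reg s4 4 != 0).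
        by rewrite (unch_reg U5).
      rewrite /J (forall_below_step P u).
      apply: run_if => /=.
        rewrite e5 => uv; apply: run_skip; rewrite J5 J4.
        by rewrite /P uv.
      move/eqP; rewrite e5 => uv; apply: run_assign => /=.
      by rewrite /P uv andbF.
    + by move=> s4 U4; rewrite /J vK.
  move=> s3 U3 e3 _.
  have r3 : reg s3 5 = size (l a) by rewrite (unch_reg U3).
  have l3 b : b < size (l a) -> arr s3 LIST b = nth 0 (l a) b.
    by move=> bl; rewrite (unch_arr _ U3) // l2.
  apply: run_if => /=; rewrite ?e3 => vK.
    apply/run_seq/run_write => /= _; apply: run_assign.
    rewrite /I lS vK size_rcons.
    split=> /= [|b]; first by rewrite r3 addn1.
    rewrite r3 nth_rcons (unch_reg U3) // x2 ltnS leq_eqVlt.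
    by case: eqP => [-> _ | _ /= bl]; [rewrite ltnn | rewrite bl l3].
  by apply: run_skip; rewrite /I lS -e3 vK.
- by move=> s2 U2 [r2 l2]; rewrite /l kept_below size_map -cardE in r2 l2.
Qed.

(** All that [emit] reads from arrays. Array 0 is not among them, so it can be overwritten with the
    output. *)
Definition input (s : store) : Prop :=
  [/\ matrix G s, holds s BLUE B & listed s].

Lemma input_unch c s s' : 5 \notin modr c ->
  all (fun a => a \notin moda c) [:: ROW; BLUE; LIST; ADJ] ->
  unch c s s' -> input s -> input s'.
Proof.
move=> c5 /and5P[cr cb cl ca _] U [sm sB [s5 sl]]; split.
- by apply: matrix_unch U sm; rewrite /= cr ca.
- exact: holds_unch U cb sB.
- by split=> [|a aK]; rewrite ?(unch_reg U) ?(unch_arr _ U) // sl.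
Qed.

Lemma put_pendant_run s x y a b (c : bool) : x != 6 -> y != 6 ->
  input s -> reg s x = a -> reg s y = b -> reg s 6 = c ->
  run m (put_pendant x y) s (fun s' => reg s' 6 = (c || pendant B K a b)).
Proof.
move=> x6 y6 [_ sB [s5 sl]] sx sy s6; rewrite /pendant.
apply: run_if => [|/eqP]; rewrite neqE /= sx sy s5 => ab.
  by apply: run_skip; rewrite s6 (negPf ab) orbF.
rewrite ab /=; apply: run_if => /=; rewrite sx s5; last move/eqP;
  rewrite subn_eq0 => aK.
  rewrite -ltnNge in aK; have e := oldvE (Ordinal aK); rewrite /= in e.
  apply: run_if => /=; rewrite sx sl // e sB.
    rewrite eqb0 negbK => vB; apply: run_skip.
    by rewrite s6 aK mem_old vB orbF.
  move=> vB; apply: run_assign => /=; rewrite aK mem_old.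
  by case: (_ \in B) vB; rewrite ?orbT.
by apply: run_assign; rewrite /= ltnNge aK orbT.
Qed.

Lemma put_entry_run s a b :
  input s -> reg s 3 = a -> reg s 4 = b ->
  run m put_entry s (fun s' =>
    reg s' 2 = (reg s 2).+1 /\
    forall p, arr s' 0 p = if p == reg s 2 then nat_of_bool (out_adj B K a b)
                           else arr s 0 p).
Proof.
move=> sin s3 s4; apply/run_seq/run_assign => /= _; set s1 := set_reg _ _ _.
have sin1 : input s1 by [].
pose c := [&& a < #|K|, b < #|K| & nat_adj G (oldv K a) (oldv K b)].
apply/run_seq; apply: (@run_mono _ _ _ (fun s' => reg s' 6 = c)).
  case: (sin) (sin1) => _ _ [s5 sl] [ctx _ _].
  apply: run_if => /=; rewrite s5 s3; last move/eqP; rewrite subn_eq0.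
    rewrite -ltnNge => aK.
    apply: run_if => /=; rewrite s5 s4; last move/eqP; rewrite subn_eq0.
      rewrite -ltnNge => bK; apply: run_assign.
      rewrite (eval_entry (u := enum_val (Ordinal aK))
        (v := enum_val (Ordinal bK)) ctx).
      + rewrite /= /c aK bK (oldvE (Ordinal aK)) (oldvE (Ordinal bK)).
        by rewrite nat_adjE.
      + by rewrite /= s3 sl // (oldvE (Ordinal aK)).
      + by rewrite /= s4 sl // (oldvE (Ordinal bK)).
    by move=> bK; apply: run_skip; rewrite /c [b < _]ltnNge bK andbF.
  by move=> aK; apply: run_skip; rewrite /c ltnNge aK.
move=> s2 U2 r2 _; have sin2 : input s2 by apply: input_unch U2 sin1.
have [s23 s24] : reg s2 3 = a /\ reg s2 4 = b by rewrite !(unch_reg U2).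
apply/run_seq; apply: run_mono (put_pendant_run _ _ sin2 s23 s24 r2) _ => //.
move=> s5 U5 r5 _; have sin5 : input s5 by apply: input_unch U5 sin2.
have [s53 s54] : reg s5 3 = a /\ reg s5 4 = b by rewrite !(unch_reg U5).
apply/run_seq; apply: run_mono (put_pendant_run _ _ sin5 s54 s53 r5) _ => //.
move=> s6 U6 r6 _; have r62 : reg s6 2 = reg s 2.
  by rewrite (unch_reg U6) // (unch_reg U5) // (unch_reg U2).
apply/run_seq/run_write => /= _; apply/run_assign; split=> /=.
  by rewrite r62 addn1.
move=> p; rewrite r62 r6; case: eqP => _; first by rewrite -orbA.
by rewrite (unch_arr _ U6) // (unch_arr _ U5) // (unch_arr _ U2).
Qed.

Lemma emit_run s n : n <= m -> reg s 8 = n -> input s ->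
  run m emit s (fun s' => reg s' 0 = n /\
    forall a b, a < n -> b < n -> arr s' 0 (a * n + b) = out_adj B K a b).
Proof.
move=> n_m s8 sin; apply/run_seq/run_assign => /= _.
set s1 := set_reg _ _ _; have sin1 : input s1 by [].
pose F p : nat := out_adj B K (p %/ n) (p %% n).
pose I a (s' : store) :=
  reg s' 2 = a * n /\ forall p, p < a * n -> arr s' 0 p = F p.
apply: run_seq; apply: (@run_for _ _ _ _ _ n I) => //.
- by move=> s' U /=; rewrite (unch_reg U).
- move=> a s2 an U2 x2 [r2 I2].
  have sin2 : input s2 by apply: input_unch U2 sin1.
  pose J b (s' : store) :=
    reg s' 2 = a * n + b /\ forall p, p < a * n + b -> arr s' 0 p = F p.
  apply: (@run_for _ _ _ _ _ n J) => //.
  + by move=> s' U /=; rewrite (unch_reg U) // (unch_reg U2).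
  + by rewrite /J addn0.
  + move=> b s3 bn U3 x3 [r3 J3].
    have sin3 : input s3 by apply: input_unch U3 sin2.
    have y3 : reg s3 3 = a by rewrite (unch_reg U3).
    apply: run_mono (put_entry_run sin3 y3 x3) _ => s4 _ [r4 e4].
    split; first by rewrite r4 r3 addnS.
    move=> p; rewrite addnS ltnS leq_eqVlt e4 r3.
    case: eqP => [-> _ | _ /= pl]; last exact: J3.
    have n0 : 0 < n by apply: leq_ltn_trans bn.
    by rewrite /F divnMDl // modnMDl divn_small // modn_small // addn0.
  + by move=> s3 _; rewrite /I mulSn addnC.
move=> s2 U2 [_ I2] _; apply: run_assign => /=.
split=> [|a b an bn]; first by rewrite (unch_reg U2).
have n0 : 0 < n by apply: leq_ltn_trans bn.
have p : a * n + b < n * n.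
  apply: (@leq_trans (a.+1 * n)); last by rewrite leq_mul2r an orbT.
  by rewrite mulSn addnC ltn_add2r.
by rewrite I2 // /F divnMDl // modnMDl divn_small // modn_small // addn0.
Qed.

End Emit.

(** * The whole program: size bound, equivalence of instances, polynomial time *)

Lemma input_store_represents I : represents (input_store I) I.
Proof.
split=> // u v /=; have n0 : 0 < nv I.1 by case: (nv I.1) u => [[]|].
by rewrite divnMDl // modnMDl divn_small // modn_small // addn0 nat_adjE.
Qed.

(** Covers loops over the at most 3n output vertices, over the truncated parameter, at most n + 1,
    and over the i thresholds. *)
Definition loops (i : nat) (I : instance) : nat := 3 * nv I.1 + i.+1.

Definition kernelized (i j : nat) (I : instance) (s : store) : Prop :=
  exists B : {set 'I_(nv I.1)}, let k := minn I.2 (nv I.1).+1 in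
  let K := kept i B in let n := out_nv K i in
  [/\ reduced j k i set0 setT B, reg s 0 = n, reg s 1 = out_k K i k &
      forall a b, a < n -> b < n -> arr s 0 (a * n + b) = out_adj B K a b].

Lemma kernel_run i j I : 0 < i -> i <= j ->
  valid (dominating_set_K_free i j) I ->
  run (loops i I) (kernel i j) (input_store I) (kernelized i j I).
Proof.
case: I => G k i0 ij [/= k_gt0 free]; set m := loops i _.
have nm : nv G <= m by rewrite /m /loops /=; lia.
set s0 := input_store _.
have [s00 s01 s0A] : [/\ reg s0 0 = nv G, reg s0 1 = k &
    forall u v : 'I_(nv G), arr s0 0 (u * nv G + v) = adj u v].
  exact: (input_store_represents (G, k)).
set k1 := minn k (nv G).+1.
have k10 : 0 < k1 by rewrite leq_min k_gt0.
apply/run_seq; apply: (@run_mono _ _ _ (fun s => reg s 1 = k1)).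
  apply: run_if => /=; last move/eqP; rewrite subn_eq0 => kn.
    by apply: run_assign; rewrite /= /k1 (minn_idPr _) ?addn1 // ltnNge.
  by apply: run_skip; rewrite /k1 (minn_idPl _) // leqW.
move=> s1 U1 r1 _; have r10 : reg s1 0 = nv G by rewrite (unch_reg U1).
apply/run_seq; apply: run_mono (load_run nm r10) _ => s2 U2 [row2 blue2 adj2] _.
have r21 : reg s2 1 = k1 by rewrite (unch_reg U2).
have k1m : k1 <= m by rewrite /m /loops /k1 geq_min /=; apply/orP; right; lia.
have im : i <= m by rewrite /m /loops; lia.
apply/run_seq; apply: run_mono (thresholds_run j im k1m r21) _.
move=> s3 U3 thr3 _.
have ctx3 : context G i j k1 s3.
  split=> //; rewrite ?(unch_reg U3) ?(unch_reg U2) //.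
  split=> [v | u v]; first by rewrite (unch_arr _ U3) // row2.
  have p : u * nv G + v < nv G * nv G.
    apply: (@leq_trans (u.+1 * nv G)); last by rewrite leq_mul2r ltn_ord orbT.
    by rewrite mulSn addnC ltn_add2r.
  by rewrite (unch_arr _ U3) // adj2 // (unch_arr _ U1) // s0A.
have X3 : holds s3 INX (set0 : {set 'I_(nv G)}).
  move=> v; rewrite (unch_arr _ U3) // (unch_arr _ U2) //.
  by rewrite (unch_arr _ U1) // inE.
have B3 : holds s3 BLUE (setT : {set 'I_(nv G)}).
  by move=> v; rewrite (unch_arr _ U3) // blue2 // inE.
have j0 : 0 < j := leq_trans i0 ij.
have X0 : #|(set0 : {set 'I_(nv G)})| + i = i by rewrite cards0.
apply/run_seq; apply: run_mono (search_run nm k10 j0 free X0 ctx3 X3 B3) _.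
move=> s4 U4 [_ [B sB red]] _.
have ctx4 : context G i j k1 s4.
  apply: context_unch U4 ctx3.
    apply/allP => x x01; apply/negP => /modr_search.
    by rewrite !inE in x01; lia.
  apply/allP => x x01; apply/negP => /moda_search.
  by rewrite !inE in x01; lia.
apply/run_seq; apply: run_mono (collect_run nm ctx4 sB) _ => s5 U5 l5 _.
have ctx5 : context G i j k1 s5 by apply: context_unch U5 _.
have sB5 : holds s5 BLUE B by apply: holds_unch U5 _ _.
set K := kept i B in l5 *.
have n'm : out_nv K i <= m.
  have : #|K| <= nv G by have := max_card (mem K); rewrite card_ord.
  by rewrite /out_nv /m /loops /=; move: #|K| => q; case: ifP => _; lia.
apply/run_seq; apply: (@run_mono _ _ _ (fun s =>
    [/\ reg s 8 = out_nv K i, reg s 1 = out_k K i k1 & input i B s])).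
  case: (ctx5) (l5) => c0 c1 cm ct [q5 _]; rewrite /sizes /out_nv /out_k.
  case: ifP => _; first by apply: run_assign; split.
  apply/run_seq/run_assign => /= _; apply: run_assign.
  by split; rewrite /= ?q5 ?c1.
move=> s6 U6 [r68 r61 in6] _.
apply: run_mono (emit_run n'm r68 in6) _ => s7 U7 [r70 a7].
by exists B; split=> //=; rewrite (unch_reg U7).
Qed.

Lemma kernel_size i j k k' b q : 0 < i -> i <= j -> 0 < k' -> k' <= k ->
  b <= thr j k' i -> q <= b + j * b.+1 ^ i ->
  3 * q <= 9 * ((j + 1) ^ (2 * (i + 1)) * k ^ (2 * i ^ 2)).
Proof.
move=> i0 ij k0 kk bt qb.
have k_gt0 := leq_trans k0 kk.
pose x := 3 * ((j + 1) * k ^ i).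
have b_lt : b < x.
  have := leq_trans bt (thr_le j i k0).
  have : k' ^ i <= k ^ i by rewrite leq_exp2r.
  have : 0 < k ^ i by rewrite expn_gt0 k_gt0.
  rewrite /x; move: (k ^ i) (k' ^ i) => p p' p0 pp bp.
  have : (j + 2 * i) * p' <= (3 * j) * p by apply: leq_mul => //; lia.
  by rewrite mulnDl mulnA mulnDr; lia.
have qx : q <= (j + 1) * x ^ i.
  have : b.+1 ^ i <= x ^ i by rewrite leq_exp2r.
  have : x <= x ^ i by rewrite -{1}[x]expn1 leq_exp2l //; lia.
  move=> xx bx; rewrite mulnDl mul1n addnC; apply: leq_trans qb _.
  by apply: leq_add; [lia | rewrite leq_mul2l bx orbT].
have le1 : 3 * q <= 3 ^ i.+1 * (j + 1) ^ i.+1 * k ^ (i ^ 2).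
  apply: (@leq_trans (3 * ((j + 1) * x ^ i))); first by rewrite leq_mul2l.
  by rewrite /x !expnMn -expnM !expnS expn0 muln1; lia.
(* This makes the constant independent of i and j. For j >= 2 already 3 <= j + 1; for i = j = 1 the
   factor 9 suffices. *)
have le3 : 3 ^ i.+1 <= 9 * (j + 1) ^ i.+1.
  have [j2 | j2] := leqP 2 j.
    by apply: leq_trans (leq_pmull _ _); rewrite // leq_exp2r //; lia.
  have -> : i = 1 by lia.
  have -> : j = 1 by lia.
  by [].
apply: leq_trans le1 _; rewrite mulnA; apply: leq_mul.
  rewrite (_ : 2 * (i + 1) = i.+1 + i.+1); last lia.
  by rewrite expnD mulnA leq_mul2r le3 orbT.
by rewrite leq_pexp2l //; lia.
Qed.

Lemma kernelized_correct i j I I' s : 0 < i -> i <= j ->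
  let P := dominating_set_K_free i j in
  let b := 9 * ((j + 1) ^ (2 * (i + 1)) * I.2 ^ (2 * i ^ 2)) in
  valid P I -> kernelized i j I s -> represents s I' ->
  [/\ valid P I', nv I'.1 <= b, I'.2 <= I.2 + b & yes P I <-> yes P I'].
Proof.
case: I I' => [G k] [H k'] i0 ij P b [/= k_gt0 free] [B].
set k1 := minn _ _; set K := kept i B; move=> [red r0 r1 rA] [/= nH kH aH].
have j0 : 0 < j := leq_trans i0 ij.
have k10 : 0 < k1 by rewrite leq_min k_gt0.
have k1k : k1 <= k by rewrite geq_minl.
rewrite {}r0 in nH; rewrite {}r1 in kH.
have adjH (a c : 'I_(nv H)) : adj a c = out_adj B K a c.
  have := aH a c; have := rA a c; rewrite nH !ltn_ord => -> //.
  by case: (adj a c); case: (out_adj _ _ _ _).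
have q_le : 3 * #|K| <= b.
  apply: (kernel_size (k' := k1) (b := #|B|)) => //.
    exact: reduced_set0 red.
  exact: card_kept.
have nHb : nv H <= b by rewrite -nH /out_nv; case: ifP => _; lia.
(* Truncating k is harmless: above n + 1 the set of all vertices is a solution for both
   parameters. *)
have yes1 : (exists2 S : {set 'I_(nv G)}, dominating S & #|S| <= k) <->
    (exists2 S : {set 'I_(nv G)}, dominating S & #|S| <= k1).
  split=> [|[S dS Sk]]; last by exists S => //; apply: leq_trans k1k.
  have [kn | kn] := leqP k (nv G).+1; first by rewrite /k1 (minn_idPl kn).
  move=> _; exists setT; first by move=> v; rewrite inE.
  by rewrite cardsT card_ord /k1 (minn_idPr (ltnW kn)).
have BK : B \subset K by apply/subsetP => v; rewrite inE => ->.
have [BT _ sound full] := red.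
split=> //.
- split; first by rewrite -kH /out_k; case: ifP => _; lia.
  move=> HF; apply: free; rewrite /out_nv in nH.
  case: eqP nH => [i1 nH | i1 nH].
    exact: (out_free1 adjH (esym nH)) HF.
  by apply: (out_free2 adjH (esym nH)) HF; lia.
- by rewrite -kH /out_k; case: ifP => _; lia.
- apply: (iff_trans yes1); rewrite -kH /out_k /out_nv in nH *.
  case: eqP nH => [i1 nH | i1 nH].
    have KB : K = B.
      by rewrite /K i1; apply/setP => v; rewrite inE andFb orbF.
    rewrite i1 in free.
    apply: (out_yes1 adjH (esym nH) KB j0 free sound) => nG.
    (* [thr j k1 1] unfolds to k1 j + 1. *)
    apply: full; rewrite cardsT card_ord /= prednK //.
    by apply: leq_trans nG _; rewrite leq_addr.
  apply: iff_trans (out_yes2 adjH (esym nH) k1 BK).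
  split=> [[S dS Sk] | [S [_ Sk SB]]].
    have i_gt1 : 1 < i by lia.
    have SB : dominates S B.
      by apply: subset_trans BT _; apply/dominating_dominates.
    have [S' [S'K S'S S'B]] := dominates_kept i_gt1 SB.
    by exists S'; split=> //; apply: leq_trans S'S Sk.
  by exists S => //; apply/dominating_dominates/sound.
Qed.

(** Polynomial time requires an output instance to exist, so [out_adj] has to be symmetric and
    irreflexive. *)
Lemma kernelized_graph i j I s : kernelized i j I s ->
  exists I', represents s I'.
Proof.
move=> [B [_ r0 r1 rA]]; set K := kept i B in r0 r1 rA.
pose n := out_nv K i.
have sym : symmetric (fun a b : 'I_n => out_adj B K a b).
  move=> a b; rewrite /out_adj andbCA [pendant _ _ a b || _]orbC.
  congr (_ || _); congr (_ && (_ && _)); rewrite /nat_adj.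
  by case: insub => [u|]; case: insub => [v|] //; rewrite adj_sym.
have irr : irreflexive (fun a b : 'I_n => out_adj B K a b).
  move=> a; apply/negP; rewrite /out_adj orbb.
  case/orP=> [/and3P[_ _] | ]; rewrite ?/nat_adj ?/pendant.
    by case: insub => [u|] //; rewrite adj_irr.
  (* A loop from [pendant] would need q = 0, but then the output has no vertices. *)
  have : a < out_nv K i := ltn_ord a.
  rewrite /out_nv; case: (~~ _); rewrite ?andbF // andbT.
  by move: #|K| => q; case: ifP => _; lia.
by exists (Graph sym irr, reg s 1); split=> //= u v; rewrite -/n rA.
Qed.

Lemma polynomially_bounded_exp a d :
  polynomially_bounded (fun x => (a * x.+1) ^ d).
Proof.
exists ((a * 2) ^ d), d => x.
have [-> | x0] := posnP x.
  apply: leq_trans (leq_addl _ _); rewrite muln1 !expnMn.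
  by rewrite leq_pmulr ?expn_gt0.
apply: leq_trans (leq_addr _ _); rewrite -expnMn.
by case: d => // d; rewrite leq_exp2r // -mulnA leq_mul2l; lia.
Qed.

Theorem theorem1 :
  exists c : nat, forall i j : nat, 1 <= i -> i <= j ->
  exists A : cmd,
    polynomial_kernel (dominating_set_K_free i j) A /\
    kernel_nv_le (dominating_set_K_free i j) A
      (fun k => c * ((j + 1) ^ (2 * (i + 1)) * k ^ (2 * i ^ 2))).
Proof.
exists 9 => i j i0 ij; exists (kernel i j).
set P := dominating_set_K_free i j; pose b k :=
  9 * ((j + 1) ^ (2 * (i + 1)) * k ^ (2 * i ^ 2)).
have correct I t I' : valid P I -> outputs (kernel i j) I t I' ->
    [/\ valid P I', nv I'.1 <= b I.2, I'.2 <= I.2 + b I.2 &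
        yes P I <-> yes P I'].
  move=> vI [s E sI']; have [t0 [s0 [E0 _ ks]]] := kernel_run i0 ij vI.
  rewrite -(exec_det E0 E) in sI'; exact: kernelized_correct ks sI'.
split; last by move=> I t I' vI /(correct _ _ _ vI)[].
exists (fun k => b k ^ 2), (fun k => k + b k); split.
  exists ((9 * (j + 1) ^ (2 * (i + 1))) ^ 2), (2 * i ^ 2 * 2) => k.
  by rewrite /b mulnA expnMn -expnM leq_addr.
split; last first.
  move=> I t I' vI /(correct _ _ _ vI)[vI' nI' kI' yesI']; split=> //.
  by rewrite /gsize leq_exp2r.
have [d le_d] := tbound_exp (kernel i j).
exists (fun x => ((i + 3) * x.+1) ^ d); first exact: polynomially_bounded_exp.
move=> I vI; have [t [s [E le_t ks]]] := kernel_run i0 ij vI.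
have [I' sI'] := kernelized_graph ks.
exists t, I'; split; first by exists s.
apply: leq_trans le_t _; apply: leq_trans (le_d _) _.
(* The left side is 3n + i + 3, and n is at most n^2, the size of the matrix. *)
have le : (loops i I).+2 <= (i + 3) * (isize I).+1.
  have : nv I.1 <= isize I.
    apply: leq_trans (leq_addr _ _); rewrite /gsize.
    by case: (nv _) => // n; rewrite leq_pmull.
  by rewrite /loops; nia.
by case: d {le_d} => // d; rewrite leq_exp2r.
Qed.
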